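(* Let $d\ge 2$ be an integer, let $\ell>0$ and $a_1,\ldots,a_d>0$ with $\min(a_1,\ldots,a_d)\ge \ell$, and put $\lambda_i=\ell/a_i$ for $i=1,\ldots,d$. A needle $\mathcal{N}_\ell$ of length $\ell$ is placed at random (in the sense specified in the context) into the grid $\mathcal{G}(a_1,\ldots,a_d)\subset\mathbb{R}^d$. Let $Z$ be the number of intersections (intersection points) between $\mathcal{N}_\ell$ and $\mathcal{G}(a_1,\ldots,a_d)$, and let $p_d(i)=P(Z=i)$ be the probability of exactly $i$ intersections. Then $$p_d(i)=\sum_{n=i}^{d}(-1)^{i+n}\binom{n}{i}\,h_d(n)\,e_n(\lambda_1,\ldots,\lambda_d),\qquad i=0,1,\ldots,d,$$ where $$h_d(n)=\frac{2^n\,\Gamma(d/2)}{\pi^{n/2}\,\Gamma((d-n)/2)\,\prod_{k=0}^{n-1}(d-n+2k)}\quad\text{if } n=0,1,\ldots,d-1,$$ $$h_d(d)=\frac{\Gamma(d/2)}{(d-1)!\,\pi^{d/2}},$$ and $e_n(\lambda_1,\ldots,\lambda_d)$, $0\le n\le d$, is the elementary symmetric polynomial of degree $n$ in the $d$ variables $\lambda_1,\ldots,\lambda_d$, with $e_0(\lambda_1,\ldots,\lambda_d)=1$. The expected value of $Z$ is $$\mathrm{E}(Z)=\frac{2\,\Gamma(d/2)}{(d-1)\sqrt{\pi}\,\Gamma((d-1)/2)}\,e_1(\lambda_1,\ldots,\lambda_d),$$ and the variance of $Z$ is $$\mathrm{Var}(Z)=\frac{2\,\Gamma(d/2)}{(d-1)\sqrt{\pi}\,\Gamma((d-1)/2)}\,e_1(\lambda_1,\ldots,\lambda_d)+\frac{4}{d\pi}\,e_2(\lambda_1,\ldots,\lambda_d)-\left(\frac{2\,\Gamma(d/2)}{(d-1)\sqrt{\pi}\,\Gamma((d-1)/2)}\,e_1(\lambda_1,\ldots,\lambda_d)\right)^2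 .$$
   Context: Grid: for $a_i>0$, $\mathcal{P}(a_i)=\{(x_1,\ldots,x_d)\in\mathbb{R}^d : x_i=k a_i \text{ for some } k\in\mathbb{Z}\}$ is the family of parallel hyperplanes orthogonal to the $x_i$-axis with distance $a_i$ apart, and $\mathcal{G}(a_1,\ldots,a_d)=\mathcal{P}(a_1)\cup\cdots\cup\mathcal{P}(a_d)$. Needle: a needle $\mathcal{N}_\ell$ is a directed line segment of length $\ell$ in $\mathbb{R}^d$. Random placement: fix a reference point of the needle (any fixed point of it, e.g. its starting point or its midpoint; i.e. fix $\tau\in[0,1]$). The reference point $X=(X_1,\ldots,X_d)$ is uniformly distributed in the hyperrectangle $\{(x_1,\ldots,x_d): 0\le x_i\le a_i,\ i=1,\ldots,d\}$ (the coordinates $X_i$ are independent and uniform on $[0,a_i]$), and the direction $U$ of the needle is uniformly distributed on the unit sphere $\mathbb{S}^{d-1}\subset\mathbb{R}^d$, independently of $X$. The needle is the segment $\mathcal{N}_\ell=\{X+(s-\tau)\ell U : s\in[0,1]\}$. Number of intersections: $Z=\#(\mathcal{N}_\ell\cap\mathcal{G}(a_1,\ldots,a_d))$. Since $\ell\le\min(a_1,\ldots,a_d)$, almost surely the needle meets at most one hyperplane of each family, and $Z$ almost surely equals the number of indices $i\in\{1,\ldots,d\}$ for which $\mathcal{N}_\ell$ meets $\mathcal{P}(a_i)$. An empty product equals $1$. *)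

(* Defs.v *)
From mathcomp Require Import all_boot all_order all_algebra.
From mathcomp Require mpoly.
From mathcomp Require Import all_classical all_reals all_analysis.

Set Implicit Arguments.
Unset Strict Implicit.
Unset Printing Implicit Defensive.

Import Order.TTheory GRing.Theory Num.Theory.

Local Open Scope classical_set_scope.
Local Open Scope ring_scope.

(* Points of R^d are d-tuples: unlike 'rV[R]_d, they carry in the library the
   product Borel sigma-algebra. *)

Section geometry.
Context {R : realType} {d : nat}.
Implicit Types (a : 'I_d -> R) (l tau : R) (x u : d.-tuple R).

Definition hyperplanes (i : 'I_d) (ai : R) : set (d.-tuple R) :=
  [set y | exists k : int, tnth y i = k%:~R * ai].

Definition grid a : set (d.-tuple R) := \bigcup_i hyperplanes i (a i).

(* [tau] locates the reference point [x] on the needle: 0 is the starting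
   point, 1/2 the midpoint. *)
Definition needle tau l x u : set (d.-tuple R) :=
  [set [tuple tnth x i + (s - tau) * l * tnth u i | i < d] | s in `[0, 1]].

(* [counting] is +oo on infinite sets, i.e. when the needle has a
   nondegenerate part inside one of the hyperplanes. *)
Definition intersections tau l a x u : \bar R :=
  counting (needle tau l x u `&` grid a).

Definition unit_sphere : set (d.-tuple R) :=
  [set u | \sum_(i < d) tnth u i ^+ 2 = 1].

Definition cone (A : set (d.-tuple R)) : set (d.-tuple R) :=
  [set [tuple r * tnth u i | i < d] | r in `]0, 1] & u in A].

End geometry.

(* d-dimensional Lebesgue measure, as an iterated product measure. *)
Fixpoint lebesgue_tuple (R : realType) (d : nat) :
    set (d.-tuple R) -> \bar R :=
  match d return set (d.-tuple R) -> \bar R with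
  | 0 => fun A => \d_[tuple] A
  | n.+1 => fun A =>
     (@lebesgue_measure R \x @lebesgue_tuple R n)%E
       [set p : R * n.-tuple R | A [tuple of p.1 :: p.2]]
  end.

(* Surface measure on the unit sphere, as it is defined by polar coordinates:
   d times the volume of the cone over the given part of the sphere. *)
Definition surface_measure (R : realType) (d : nat) (A : set (d.-tuple R)) :
    \bar R :=
  (d%:R%:E * lebesgue_tuple (cone (A `&` unit_sphere)))%E.

Section randomness.
Context {R : realType} {disp : measure_display} {T : measurableType disp}.
Variable P : probability T R.

Definition mutually_independent (I : finType) (Y : I -> T -> R) :=
  forall (J : {set I}) (B : I -> set R), (forall i, measurable (B i)) ->
  (P (\bigcap_(i in [set` J]) Y i @^-1` B i) =
   \prod_(i in J) P (Y i @^-1` B i))%E.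

Definition independent_vectors (d : nat) (X U : T -> d.-tuple R) :=
  forall A B : set (d.-tuple R), measurable A -> measurable B ->
  P (X @^-1` A `&` U @^-1` B) = (P (X @^-1` A) * P (U @^-1` B))%E.

Definition uniform_on_box (d : nat) (a : 'I_d -> R) (a0 : forall i, 0 < a i)
    (X : T -> d.-tuple R) :=
  mutually_independent (fun i w => tnth (X w) i) /\
  forall (i : 'I_d) (B : set R), measurable B ->
    P [set w | B (tnth (X w) i)] = uniform_prob (a0 i) B.

Definition uniform_on_sphere (d : nat) (U : T -> d.-tuple R) :=
  forall A : set (d.-tuple R), measurable A ->
  P (U @^-1` A) =
  ((fine (surface_measure (@unit_sphere R d)))^-1%:E * surface_measure A)%E.

End randomness.

Definition Gamma (R : realType) (x : R) : R :=
  \int[lebesgue_measure]_(t in `]0, +oo[) (t `^ (x - 1) * expR (- t)).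

Definition elem_sym (R : realType) (d n : nat) (lambda : 'I_d -> R) : R :=
  mpoly.meval lambda (mpoly.mesym d R n).

Definition h_coef (R : realType) (d n : nat) : R :=
  if (n < d)%N then
    2 ^+ n * Gamma (d%:R / 2) /
    (pi `^ (n%:R / 2) * Gamma ((d%:R - n%:R) / 2) *
     \prod_(0 <= k < n) (d%:R - n%:R + 2 * k%:R))
  else Gamma (d%:R / 2) / (d.-1`!%:R * pi `^ (d%:R / 2)).

(* Main.v *)
From HB Require Import structures.
Require Import Defs.
From mathcomp Require Import all_boot all_order all_algebra.
From mathcomp Require mpoly.
From mathcomp Require Import all_classical all_reals all_analysis.
From mathcomp Require Import measurable_realfun.
From mathcomp Require Import ring lra.

Set Implicit Arguments.
Unset Strict Implicit.
Unset Printing Implicit Defensive.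

Import Order.TTheory GRing.Theory Num.Theory.
Import numFieldNormedType.Exports.

Local Open Scope classical_set_scope.
Local Open Scope ring_scope.

(* Given the direction u, the needle crosses the family P(a_i) with probability
   l |u_i| / a_i, independently over i, so the n-th binomial moment of the
   number of crossed families is E[e_n(lambda_1 |U_1|, ..., lambda_d |U_d|)]. By
   symmetry this is e_n(lambda) times E[|U_1 ... U_n|], and binomial inversion
   gives the distribution, the mean and the variance.

   E[prod_{j in J} |U_j|], #|J| = n, is computed as for Gaussian vectors. With
   B = {0 < |x| <= 1}, the law of U is the image of the uniform law on B under
   x |-> x / |x|, and, for g homogeneous of degree 0,
     int g(x) |x|^n e^{-|x|^2} dx = (d / 2) Gamma((d + n) / 2) int_B g,
   while the left-hand side factors into one-dimensional integrals when
   g(x) |x|^n is a product of coordinates; the case n = 0 gives the volume of B.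

   That Z counts crossed families fails on a null set only, but P need not be
   complete, so the measurability of Z is proved everywhere. *)

(** * Lebesgue measure on tuples *)

(** [surface_measure] is itself made of volumes of cones, so the polar identity can rest on Tonelli
    and on the dilation [x = sqrt u * y] alone, without spherical coordinates. Both sides come from
    one double integral: [(2 / d) * |x|^(-d)] is written as the integral of [u^(-d/2 - 1)] over
    [u >= |x|^2], a condition that the dilation turns into [|y| <= 1]; what remains in [u] is a
    Gamma integral. All this is nonnegative and takes place in the extended reals. That Gamma is
    finite and positive at positive multiples of 1/2 is then read off the identity, whose Gaussian
    side is an explicit power of [sqrt pi].

    The number of points differs from the number of crossed families when the needle lies in a
    hyperplane, when it meets two hyperplanes of one family, or when it meets two families at the
    same point. In the first two cases (the second by [l <= a i]) the start of the needle is on a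
    hyperplane. For a fixed direction, each of these events confines one coordinate of [X], given
    the others, to countably many values. *)

Section image_measure.
Context d1 d2 (X : measurableType d1) (Y : measurableType d2) (R : realType).
Variables (mu : {measure set X -> \bar R}) (phi : X -> Y).

(* Carrying the proof of measurability makes the image an inferable measure. *)
Definition image_measure (_ : measurable_fun setT phi) := pushforward mu phi.

Variable mphi : measurable_fun setT phi.

HB.instance Definition _ := Measure.copy (image_measure mphi)
  (measure_function_pushforward__canonical__measure_function_Measure mu mphi).

Lemma ge0_integral_image (f : Y -> \bar R) :
  (forall y, 0 <= f y)%E -> measurable_fun setT f ->
  (\int[image_measure mphi]_y f y = \int[mu]_x f (phi x))%E.
Proof.
by move=> f0 mf; rewrite (ge0_integral_pushforward mphi)// preimage_setT.
Qed.

End image_measure.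

Section lebesgue_tuple_measure.
Context {R : realType}.

Definition tcons n (p : R * n.-tuple R) : n.+1.-tuple R := [tuple of p.1 ::
  p.2].

Lemma measurable_tcons n : measurable_fun setT (@tcons n).
Proof. by apply: (@measurable_cons _ _ _ _ fst n snd). Qed.

Definition tuncons n (t : n.+1.-tuple R) : R * n.-tuple R :=
  (thead t, [tuple of behead t]).

Lemma tconsK n : cancel (@tcons n) (@tuncons n).
Proof.
by move=> [x t]; rewrite /tuncons /tcons/= theadE; congr pair; exact: val_inj.
Qed.

Lemma measurable_tuncons n : measurable_fun setT (@tuncons n).
Proof.
apply/measurable_fun_pairP; split; first exact: (measurable_tnth ord0).
exact: measurable_behead.
Qed.

(** The recursion defining [lebesgue_tuple] yields bare set functions, while Tonelli needs a bundled
    measure at every stage. An equality with some bundled measure can be carried through the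
    induction and rewritten with. *)
Definition sigma_finite_measure_spec n (mu : set (n.-tuple R) -> \bar R) :=
  exists m : {sigma_finite_measure set (n.-tuple R) -> \bar R}, mu = m.

Lemma sigma_finite_image_tcons n
    (m : {sigma_finite_measure set (n.-tuple R) -> \bar R}) :
  sigma_finite setT (image_measure (@lebesgue_measure R \x m)%E
                       (@measurable_tcons n)).
Proof.
have /sigma_finiteP[F [TF ndF Foo]] := sigma_finiteT (@lebesgue_measure R).
have /sigma_finiteP[G [TG ndG Goo]] := sigma_finiteT m.
exists (fun k => @tuncons n @^-1` (F k `*` G k)).
  apply/seteqP; split => // t _.
  have : setT (tuncons t).1 by [].
  have : setT (tuncons t).2 by [].
  (* Both exhaustions increase, so the larger index serves for both. *)
  rewrite TF TG => -[p _ Gp] [q _ Fq]; exists (maxn p q) => //; split.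
    exact: (subsetPset _ _ (ndF _ _ (leq_maxr p q))).
  exact: (subsetPset _ _ (ndG _ _ (leq_maxl p q))).
move=> k; have [mF Fk] := Foo k; have [mG Gk] := Goo k; split.
  rewrite -[X in measurable X]setTI; apply: measurable_tuncons => //.
  exact: measurableX.
rewrite /image_measure /pushforward (_ : _ @^-1` _ = F k `*` G k)//.
  apply: (@le_lt_trans _ _ (lebesgue_measure (F k) * m (G k))%E).
    by rewrite -(product_measure1E (@lebesgue_measure R) m mF mG).
  by rewrite lte_mul_pinfty// ge0_fin_numE.
by apply/seteqP; split => p; rewrite /preimage /mkset tconsK.
Qed.

Lemma lebesgue_tuple_spec n : sigma_finite_measure_spec (@lebesgue_tuple R n).
Proof.
elim: n => [|n [m IH]].
  exists (@dirac _ (0.-tuple R) [tuple] R); reflexivity.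
pose mu := image_measure (@lebesgue_measure R \x m)%E (@measurable_tcons n).
pose H := Measure_isSigmaFinite.Build _ _ _ mu (sigma_finite_image_tcons m).
pose mu' : {sigma_finite_measure set _ -> \bar R} := HB.pack mu H.
by exists mu'; rewrite /= IH.
Qed.

Lemma lebesgue_tuple_sigma_finite n :
  sigma_finite setT (@lebesgue_tuple R n).
Proof. by have [m ->] := lebesgue_tuple_spec n; exact: sigma_finiteT. Qed.

Lemma lebesgue_tuple0 n : @lebesgue_tuple R n set0 = 0%E.
Proof. by have [m ->] := lebesgue_tuple_spec n; exact: measure0. Qed.

Lemma lebesgue_tuple_ge0 n A : (0 <= @lebesgue_tuple R n A)%E.
Proof. by have [m ->] := lebesgue_tuple_spec n; exact: measure_ge0. Qed.

Lemma lebesgue_tuple_sigma_additive n :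
  semi_sigma_additive (@lebesgue_tuple R n).
Proof.
by have [m ->] := lebesgue_tuple_spec n; exact: measure_semi_sigma_additive.
Qed.

HB.instance Definition _ n := isMeasure.Build _ _ _ (@lebesgue_tuple R n)
  (@lebesgue_tuple0 n) (@lebesgue_tuple_ge0 n)
  (@lebesgue_tuple_sigma_additive n).

HB.instance Definition _ n := Measure_isSigmaFinite.Build _ _ _
  (@lebesgue_tuple R n) (@lebesgue_tuple_sigma_finite n).

Local Open Scope ereal_scope.

Lemma integral_lebesgue_tupleS n (f : n.+1.-tuple R -> \bar R) :
  (forall x, 0 <= f x) -> measurable_fun setT f ->
  \int[@lebesgue_tuple R n.+1]_x f x =
  \int[lebesgue_measure]_x \int[@lebesgue_tuple R n]_t f (tcons (x, t)).
Proof.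
move=> f0 mf.
transitivity (\int[image_measure (@lebesgue_measure R \x @lebesgue_tuple R n)
  (@measurable_tcons n)]_x f x); first exact: eq_measure_integral.
rewrite ge0_integral_image//= fubini_tonelli1//.
by apply: measurableT_comp => //; exact: measurable_tcons.
Qed.

Lemma integral_lebesgue_tuple0 (f : 0.-tuple R -> \bar R) :
  (forall x, 0 <= f x) -> measurable_fun setT f ->
  \int[@lebesgue_tuple R 0]_x f x = f [tuple].
Proof.
move=> f0 mf.
transitivity (\int[@dirac _ (0.-tuple R) [tuple] R]_x f x).
  by apply: eq_measure_integral => A mA _.
by rewrite integral_dirac// diracT mul1e.
Qed.

(** Uniqueness of Lebesgue measure: [r] times its image under the dilation gives each half-open
    interval its length. *)
Lemma lebesgue_scale (r : R) (A : set R) : (0 < r)%R -> measurable A ->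
  lebesgue_measure ((fun x : R => r * x)%R @^-1` A) =
    r^-1%:E * lebesgue_measure A.
Proof.
move=> r0 mA.
have mr : measurable_fun setT (fun x : measurableTypeR R =>
  r * x : measurableTypeR R)%R.
  exact: measurable_funM.
have r0' : (0 <= r)%R by exact: ltW.
pose nu := mscale (NngNum r0') (image_measure (@lebesgue_measure R) mr).
suff -> : lebesgue_measure A = nu A.
  by rewrite /nu /mscale /= muleA -EFinM mulVf ?mul1e// gt_eqF.
apply: lebesgue_measure_unique => //= _ [[a b] _ <-]/=.
rewrite /nu /mscale /= /image_measure /pushforward.
rewrite (_ : _ @^-1` _ = `](a / r)%R, (b / r)%R]%classic); last first.
  apply/seteqP; split=> x/=;
    rewrite !in_itv/= ltr_pdivrMr// ler_pdivlMr// mulrC//.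
rewrite !lebesgue_measure_itv/= !lte_fin ltr_pM2r ?invr_gt0//.
case: ifPn => _; last by rewrite mule0.
by rewrite -!EFinD -EFinM -mulrBl mulrC divfK// gt_eqF.
Qed.

Lemma integral_lebesgue_scale (r : R) (f : R -> \bar R) : (0 < r)%R ->
  (forall x, 0 <= f x) -> measurable_fun setT f ->
  \int[lebesgue_measure]_x f (r * x)%R = r^-1%:E * \int[lebesgue_measure]_x f x.
Proof.
move=> r0 f0 mf.
have mr : measurable_fun setT (fun x : measurableTypeR R =>
  r * x : measurableTypeR R)%R.
  exact: measurable_funM.
have r0' : (0 <= r^-1)%R by rewrite invr_ge0 ltW.
transitivity (\int[image_measure (@lebesgue_measure R) mr]_x f x).
  by rewrite ge0_integral_image.
transitivity (\int[mscale (NngNum r0') (@lebesgue_measure R)]_x f x).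
  by apply: eq_measure_integral => A mA _; exact: lebesgue_scale.
by rewrite ge0_integral_mscale.
Qed.

Definition tscale n (r : R) (t : n.-tuple R) : n.-tuple R :=
  [tuple (r * tnth t i)%R | i < n].

Lemma measurable_tscale n r : measurable_fun setT (@tscale n r).
Proof.
apply/measurable_fun_tnthP => i.
rewrite (_ : _ \o _ = (fun t => r * tnth t i)%R).
  by apply: measurable_funM => //; exact: measurable_tnth.
by apply/funext => t /=; rewrite tnth_mktuple.
Qed.

Lemma tscale_tcons n r x (t : n.-tuple R) :
  tscale r (tcons (x, t)) = tcons ((r * x)%R, tscale r t).
Proof.
apply: eq_from_tnth => i; rewrite tnth_mktuple.
have [j ->|->] := unliftP ord0 i; last by [].
by rewrite !tnthS tnth_mktuple.
Qed.

(** Induction on the dimension: Tonelli splits off the head coordinate, and each coordinate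
    contributes a factor [r^-1]. *)
Lemma integral_lebesgue_tuple_scale n (r : R) (f : n.-tuple R -> \bar R) :
  (0 < r)%R -> (forall x, 0 <= f x) -> measurable_fun setT f ->
  \int[@lebesgue_tuple R n]_x f (tscale r x) =
  (r ^- n)%:E * \int[@lebesgue_tuple R n]_x f x.
Proof.
move=> r0; elim: n f => [|n IH] f f0 mf.
  rewrite !integral_lebesgue_tuple0//; last first.
    by apply: (measurableT_comp mf); exact: measurable_tscale.
  by rewrite expr0 invr1 mul1e [tscale _ _]tuple0.
have mF : measurable_fun setT
    (fun x => \int[@lebesgue_tuple R n]_t f (tcons (x, t))).
  apply: (@measurable_fun_fubini_tonelli_F _ _ _ _ _ (@lebesgue_tuple R n)
    (f \o @tcons n)) => [|x].
    by apply: (measurableT_comp mf); exact: measurable_tcons.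
  exact: f0.
have mfr : measurable_fun setT (fun t => f (tscale r t)).
  by apply: (measurableT_comp mf); exact: measurable_tscale.
rewrite integral_lebesgue_tupleS//.
transitivity (\int[lebesgue_measure]_x ((r ^- n)%:E *
    \int[@lebesgue_tuple R n]_t f (tcons ((r * x)%R, t)))).
  apply: eq_integral => x _; under eq_integral do rewrite tscale_tcons.
  rewrite (IH (fun t => f (tcons ((r * x)%R, t))))//.
  apply: (measurableT_comp mf).
  exact: (@measurable_cons _ _ _ _ (fun=> (r * x)%R) n id).
rewrite ge0_integralZl//; first last.
- by rewrite lee_fin invr_ge0 exprn_ge0// ltW.
- by move=> x _; exact: integral_ge0.
- by apply: (measurableT_comp mF); exact: measurable_funM.
rewrite (integral_lebesgue_scale r0
  (f := fun x => \int[@lebesgue_tuple R n]_t f (tcons (x, t))))//; last first.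
  by move=> x; exact: integral_ge0.
by rewrite muleA -EFinM exprSr invfM integral_lebesgue_tupleS.
Qed.

End lebesgue_tuple_measure.

(** * One-dimensional integrals *)

Section real_integrals.
Context {R : realType}.
Local Notation mu := (@lebesgue_measure R).

Lemma continuous_powR (p x : R) : 0 < x -> {for x, continuous (fun u : R =>
  u `^ p)}.
Proof.
move=> x0; apply: differentiable_continuous; apply/derivable1_diffP.
by apply: derivable_powR; rewrite in_itv/= x0.
Qed.

Lemma integral_powR_tail (p s : R) : 0 < p -> 0 < s ->
  (\int[mu]_(u in `[s, +oo[) (u `^ (- p - 1))%:E = (s `^ (- p) / p)%:E)%E.
Proof.
move=> p0 s0.
pose F (u : R) : R := - p^-1 * u `^ (- p).
have dF (x : R) : 0 < x -> is_derive x 1 F (x `^ (- p - 1)).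
  move=> x0.
  have H := is_derive1_powR (- p) x0.
  apply: is_derive_eq.
  rewrite /GRing.scale/=.
  by rewrite mulrA mulrNN mulVf ?mul1r// gt_eqF.
have cF (x : R) : 0 < x -> {for x, continuous F}.
  move=> x0; apply: differentiable_continuous; apply/derivable1_diffP.
  exact: (@ex_derive _ _ _ _ _ _ _ (dF x x0)).
rewrite (@ge0_continuous_FTC2y R (fun u => u `^ (- p - 1)) F s 0).
- by rewrite -EFinB /F; congr EFin; rewrite sub0r mulNr opprK mulrC.
- by move=> x _; exact: powR_ge0.
- apply: continuous_in_subspaceT => x; rewrite inE/= in_itv/= andbT => sx.
  by apply: continuous_powR; exact: lt_le_trans sx.
- rewrite -(mulr0 (- p^-1)); apply: cvgM; first exact: cvg_cst.
  apply: (@cvg_trans _ (expR (- (p * ln u)) @[u --> +oo])).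
    apply: near_eq_cvg; near=> u; have u0 : 0 < u by [].
    by rewrite /powR gt_eqF// mulNr.
  apply: (@cvg_comp _ _ _ (fun u => p * ln u) (fun z =>
    expR (- z)) _ (pinfty_nbhs R)).
    apply: gt0_cvgMry => //; apply/cvgryPge => y; near=> u.
    have u0 : 0 < u by [].
    rewrite -ler_expR lnK ?posrE//.
  exact: cvgr_expR.
- by move=> x sx; apply: (@ex_derive _ _ _ _ _ _ _ (dF x _));
  exact: lt_trans sx.
- by apply: cvg_at_right_filter; exact: cF.
- move=> x; rewrite in_itv/= andbT => sx.
  by rewrite derive1E (@derive_val _ _ _ _ _ _ _ (dF x _))//;
    exact: lt_trans sx.
Unshelve. all: by end_near. Qed.

Lemma integral_expR_tail (u a : R) : 0 < u ->
  (\int[mu]_(s in `[a, +oo[) (expR (- (u * s)))%:E =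
    (expR (- (u * a)) / u)%:E)%E.
Proof.
move=> u0.
pose F (s : R) : R := - u^-1 * expR (- (u * s)).
have dF (x : R) : is_derive x 1 F (expR (- (u * x))).
  apply: is_derive_eq.
  rewrite /GRing.scale/= mulr1 mulrN mulrNN mulrCA mulVf ?mulr1// gt_eqF//.
have cF (x : R) : {for x, continuous F}.
  by apply: differentiable_continuous; apply/derivable1_diffP; exact: ex_derive.
rewrite (@ge0_continuous_FTC2y R (fun s => expR (- (u * s))) F a 0).
- by rewrite -EFinB /F; congr EFin; rewrite sub0r mulNr opprK mulrC.
- by move=> x _; exact: expR_ge0.
- apply: continuous_subspaceT => x.
  apply: differentiable_continuous; apply/derivable1_diffP; exact: ex_derive.
- rewrite -(mulr0 (- u^-1)); apply: cvgM; first exact: cvg_cst.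
  apply: (@cvg_comp _ _ _ (fun s => u * s) (fun z =>
    expR (- z)) _ (pinfty_nbhs R)).
    by apply: gt0_cvgMry.
  exact: cvgr_expR.
- by move=> x _; exact: ex_derive.
- by apply: cvg_at_right_filter; exact: cF.
- by move=> x _; rewrite derive1E; exact: derive_val.
Qed.

(** By evenness this is twice the integral over the half-line, where [x * exp (- x^2)] has an
    elementary antiderivative. *)
Lemma integral_abs_gauss :
  (\int[mu]_x (`|x| * expR (- x ^+ 2))%:E = 1)%E.
Proof.
rewrite (ge0_symfun_integralT (f := fun x => `|x| * expR (- x ^+ 2))).
- rewrite (_ : [set x | 0 <= x]%R = `[0%R, +oo[%classic); last first.
    by apply/seteqP; split => x/=; rewrite in_itv/= andbT.
  pose F (x : R) : R := - 2^-1 * expR (- x ^+ 2).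
  have dF (x : R) : is_derive x 1 F (x * expR (- x ^+ 2)).
    apply: is_derive_eq.
    by rewrite /GRing.scale/=; field.
  under eq_integral => x.
    rewrite inE/= in_itv/= andbT => x0; rewrite ger0_norm//; over.
  have cF (x : R) : {for x, continuous F}.
    by apply: differentiable_continuous; apply/derivable1_diffP;
      exact: ex_derive.
  rewrite (@ge0_continuous_FTC2y R (fun x => x * expR (- x ^+ 2)) F 0 0).
  + rewrite -EFinB -EFinM /F; congr EFin.
    by rewrite expr0n/= oppr0 expR0; field.
  + by move=> x x0; rewrite mulr_ge0// expR_ge0.
  + apply: continuous_subspaceT => x.
    apply: differentiable_continuous; apply/derivable1_diffP; exact: ex_derive.
  + rewrite -(mulr0 (- 2^-1)); apply: cvgM; first exact: cvg_cst.
    exact: cvg_gauss_fun.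
  + by move=> x _; exact: ex_derive.
  + by apply: cvg_at_right_filter; exact: cF.
  + by move=> x _; rewrite derive1E; exact: derive_val.
- by move=> x; rewrite mulr_ge0// expR_ge0.
- move=> x; apply: cvgM; first exact: cvg_norm.
  exact: continuous_gauss_fun.
- by move=> x /=; rewrite normrN sqrrN.
Qed.

End real_integrals.

(** * The Gamma function *)

Section gamma_integral.
Context {R : realType}.
Local Notation mu := (@lebesgue_measure R).

(** The Gamma integral before [fine] is applied, so that Tonelli can be used while finiteness is
    still unknown; [Gamma] sends an infinite value to 0. *)
Definition egamma (x : R) : \bar R :=
  (\int[mu]_(t in `]0%R, +oo[) (t `^ (x - 1) * expR (- t))%:E)%E.

Lemma GammaE x : Gamma x = fine (egamma x).
Proof. by []. Qed.

Lemma egamma_ge0 x : (0 <= egamma x)%E.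
Proof.
by apply: integral_ge0 => t _; rewrite lee_fin mulr_ge0 ?powR_ge0 ?expR_ge0.
Qed.

(** Domains of integration are encoded as [if ... else 0] on the whole space, so that Tonelli and
    dilations apply to full products even when the domain of one variable depends on the other. *)
Lemma measurable_if0 d (T : measurableType d) (b : T -> bool) (f : T -> R) :
  measurable_fun setT b -> measurable_fun setT f ->
  measurable_fun setT (fun x => if b x then f x else 0).
Proof. by move=> mb mf; exact: measurable_fun_ifT. Qed.

Lemma integral_if0 d (T : measurableType d) (m : {measure set T -> \bar R})
    (b : T -> bool) (f : T -> R) :
  (\int[m]_x (if b x then f x else 0)%:E =
   \int[m]_(x in [set x | b x]) (f x)%:E)%E.
Proof.
rewrite [RHS]integral_mkcond; apply: eq_integral => x _.
rewrite patchE (_ : (x \in _) = b x); first by case: (b x).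
by apply/idP/idP => [/set_mem//|bx]; exact/mem_set.
Qed.

Lemma integral_if0r (b : R -> bool) (i : interval R) (f : R -> R) :
  (forall x, b x = (x \in i)) ->
  (\int[mu]_x (if b x then f x else 0)%:E =
   \int[mu]_(x in [set` i]) (f x)%:E)%E.
Proof.
move=> bi; rewrite integral_if0; congr integral.
by apply/seteqP; split => x /=; rewrite bi.
Qed.

Lemma egamma_scale (c s : R) : 0 < s ->
  (\int[mu]_(u in `]0%R, +oo[) (u `^ (c - 1) * expR (- (s * u)))%:E =
   (s `^ (- c))%:E * egamma c)%E.
Proof.
move=> s0.
pose f (v : R) : R := if 0 < v then v `^ (c - 1) * expR (- v) else 0.
have f0 v : 0 <= f v.
  by rewrite /f; case: ifP => // _; rewrite mulr_ge0 ?powR_ge0 ?expR_ge0.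
have mf : measurable_fun setT f.
  apply: measurable_if0; first exact: measurable_fun_ltr.
  apply: measurable_funM; first exact: measurable_powR.
  by apply: measurableT_comp => //; exact: measurable_oppr.
have E : egamma c = (\int[mu]_x (f x)%:E)%E.
  rewrite /f (@integral_if0r _ `]0, +oo[)// => x.
  by rewrite in_itv/= andbT.
rewrite E.
have := @integral_lebesgue_scale R s (fun x => (f x)%:E) s0.
move=> /(_ (fun x => f0 x)) => H.
have {}H : (\int[mu]_x (f x)%:E = s%:E * \int[mu]_x (f (s * x))%:E)%E.
  rewrite H; last exact/measurable_EFinP.
  by rewrite muleA -EFinM divff ?gt_eqF// mul1e.
rewrite H muleA -EFinM -(@integral_if0r (fun u => 0 < u) `]0, +oo[); last first.
  by move=> x; rewrite in_itv/= andbT.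
rewrite -ge0_integralZl//; last 3 first.
- apply/measurable_EFinP; apply: (measurableT_comp mf); exact: measurable_funM.
- by move=> x _; rewrite lee_fin.
- by rewrite lee_fin mulr_ge0 ?powR_ge0// ltW.
apply: eq_integral => u _; rewrite -EFinM; congr EFin.
rewrite /f pmulr_rgt0//; case: ifPn => // u0; last by rewrite mulr0.
rewrite powRM ?ltW// !mulrA; congr (_ * _).
(* The exponents of [s], namely [- c], [1] from the measure and [c - 1] from the integrand, add up
   to 0. *)
rewrite -[X in _ * X * _ * _](powRr1 (ltW s0)) -!powRD ?(gt_eqF s0) ?implybT//.
by rewrite (_ : - c + 1 + (c - 1) = 0) ?powRr0 ?mul1r//; ring.
Qed.

(* Tonelli for [u^x * exp (- s u)] on [s >= 1], [u > 0]: unlike an integration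
   by parts, this has no boundary term at 0 when [x < 1]. *)
Lemma egammaD1 x : 0 < x -> (egamma (x + 1) = x%:E * egamma x)%E.
Proof.
move=> x0.
pose k (z : R * R) : R := if 0 < z.2 then
  (if 1 <= z.1 then z.2 `^ (x + 1 - 1) * expR (- (z.1 * z.2)) else 0) else 0.
have k0 z : 0 <= k z.
  rewrite /k; case: ifP => // _; case: ifP => // _.
  by rewrite mulr_ge0 ?powR_ge0 ?expR_ge0.
have mk : measurable_fun setT k.
  apply: measurable_if0; first exact: measurable_fun_ltr.
  apply: measurable_if0; first exact: measurable_fun_ler.
  apply: measurable_funM;
    first exact: (measurableT_comp (@measurable_powR R _)).
  apply: measurableT_comp => //; apply: measurableT_comp => //.
  exact: measurable_funM.
have := @fubini_tonelli _ _ _ _ R mu mu (fun z => (k z)%:E).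
have mk' : measurable_fun setT (EFin \o k) by exact/measurable_EFinP.
move=> /(_ mk' (fun z => k0 z)) /=.
(* Over [u] first: the scaled Gamma integral leaves [s^(- x - 1)], whose tail from 1 is [1 / x]. *)
have -> : (\int[mu]_s \int[mu]_u (k (s, u))%:E =
   (x^-1)%:E * egamma (x + 1))%E.
  transitivity (\int[mu]_(s in `[1%R, +oo[)
      ((s `^ (- x - 1))%:E * egamma (x + 1)))%E.
    rewrite [RHS]integral_mkcond; apply: eq_integral => s _.
    rewrite patchE mem_setE in_itv/= andbT /k/=.
    rewrite (@integral_if0r _ `]0, +oo[); last first.
      by move=> u; rewrite in_itv/= andbT.
    case: ifPn => s1.
      by rewrite egamma_scale ?opprD//; exact: lt_le_trans s1.
    by rewrite integral0.
  rewrite ge0_integralZr//; last 3 first.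
  - by apply/measurable_EFinP; apply: measurable_funTS; exact: measurable_powR.
  - by move=> s _; rewrite lee_fin powR_ge0.
  - exact: egamma_ge0.
  by rewrite integral_powR_tail// powR1 mul1r.
(* Over [s] first: the exponential tail is [exp (- u) / u], and the division lowers the exponent of
   [u] to [x - 1]. *)
have -> : (\int[mu]_u \int[mu]_s (k (s, u))%:E = egamma x)%E.
  rewrite /egamma [RHS]integral_mkcond; apply: eq_integral => u _.
  rewrite patchE mem_setE in_itv/= andbT /k/=.
  case: ifPn => u0; last by rewrite integral0.
  rewrite (@integral_if0r _ `[1, +oo[); last first.
    by move=> s; rewrite in_itv/= andbT.
  under eq_integral do rewrite mulrC [_ * u]mulrC EFinM.
  rewrite ge0_integralZr//; last 2 first.
  - apply/measurable_EFinP; apply: measurable_funTS.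
    apply: measurableT_comp => //; apply: measurableT_comp => //.
  - by rewrite lee_fin powR_ge0.
  rewrite integral_expR_tail// mulr1 -EFinM; congr EFin.
  rewrite mulrC mulrA addrK mulrAC; congr (_ * _).
  by rewrite powRB ?powRr1 ?ltW// (gt_eqF u0) implybT.
by move=> <-; rewrite muleA -EFinM divff ?mul1e// gt_eqF.
Qed.

End gamma_integral.

(** * Integration in polar coordinates *)

Section polar.
Context {R : realType}.
Local Notation mu := (@lebesgue_measure R).

Definition sqn d (x : d.-tuple R) : R := \sum_(i < d) tnth x i ^+ 2.

Lemma sqn_ge0 d (x : d.-tuple R) : 0 <= sqn x.
Proof. by apply: sumr_ge0 => i _; exact: sqr_ge0. Qed.

Lemma sqn_tscale d r (x : d.-tuple R) : sqn (tscale r x) = r ^+ 2 * sqn x.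
Proof.
by rewrite /sqn mulr_sumr; apply: eq_bigr => i _; rewrite tnth_mktuple exprMn.
Qed.

Lemma measurable_sqn d : measurable_fun setT (@sqn d).
Proof.
rewrite /sqn; apply: measurable_sum => i.
by apply: measurable_funX; exact: measurable_tnth.
Qed.

Section identity.
Variables (d : nat) (g : d.-tuple R -> R) (q : R).
Hypotheses (d0 : (0 < d)%N) (g0 : forall x, 0 <= g x).
Hypothesis mg : measurable_fun setT g.
Hypothesis hg : forall r x, 0 < r -> g (tscale r x) = g x.

Let p : R := d%:R / 2.

Let p0 : 0 < p. Proof. by rewrite divr_gt0// ltr0n. Qed.

(* The integral of [k] is computed over [u] first, and over [x] first after the
   dilation [x = sqrt u * y], which turns [k] into [k2]. *)
Let k (z : R * d.-tuple R) : R := if 0 < sqn z.2 then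
  (if sqn z.2 <= z.1 then
    z.1 `^ (- p - 1) * (g z.2 * sqn z.2 `^ (p + q) * expR (- sqn z.2))
  else 0) else 0.

Let k2 (z : R * d.-tuple R) : R := if 0 < z.1 then (if 0 < sqn z.2 <= 1 then
    g z.2 * sqn z.2 `^ (p + q) *
      (z.1 `^ (p + q - 1) * expR (- (sqn z.2 * z.1)))
  else 0) else 0.

Let msqn2 : measurable_fun setT (fun z : R * d.-tuple R => sqn z.2).
Proof. by apply: measurableT_comp => //; exact: measurable_sqn. Qed.

Let k_ge0 z : 0 <= k z.
Proof.
rewrite /k; case: ifP => // _; case: ifP => // _.
by rewrite !mulr_ge0 ?powR_ge0 ?expR_ge0.
Qed.

Let k2_ge0 z : 0 <= k2 z.
Proof.
rewrite /k2; case: ifP => // _; case: ifP => // _.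
by rewrite !mulr_ge0 ?powR_ge0 ?expR_ge0.
Qed.

Let measurable_k : measurable_fun setT k.
Proof.
apply: measurable_if0; first exact: measurable_fun_ltr.
apply: measurable_if0; first exact: measurable_fun_ler.
apply: measurable_funM.
  exact: (measurableT_comp (@measurable_powR R _)).
apply: measurable_funM; last by do 2 apply: measurableT_comp => //.
apply: measurable_funM; first exact: (measurableT_comp mg).
exact: (measurableT_comp (@measurable_powR R _)).
Qed.

Let measurable_k2 : measurable_fun setT k2.
Proof.
apply: measurable_if0; first exact: measurable_fun_ltr.
apply: measurable_if0.
  by apply: measurable_and;
    [exact: measurable_fun_ltr|exact: measurable_fun_ler].
apply: measurable_funM.
  apply: measurable_funM; first exact: (measurableT_comp mg).
  exact: (measurableT_comp (@measurable_powR R _)).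
apply: measurable_funM; first exact: (measurableT_comp (@measurable_powR R _)).
by do 2 apply: measurableT_comp => //; exact: measurable_funM.
Qed.

Let gauss_part : (\int[@lebesgue_tuple R d]_x \int[mu]_u (k (u, x))%:E =
  p^-1%:E * \int[@lebesgue_tuple R d]_x
     (if (0 < sqn x)%R then g x * sqn x `^ q * expR (- sqn x) else 0)%:E)%E.
Proof.
rewrite -ge0_integralZl//; last 3 first.
- apply/measurable_EFinP; apply: measurable_if0.
    by apply: measurable_fun_ltr => //; exact: measurable_sqn.
  apply: measurable_funM.
    apply: measurable_funM => //.
    by apply: (measurableT_comp (@measurable_powR R _)); exact: measurable_sqn.
  by do 2 apply: measurableT_comp => //; exact: measurable_sqn.
- move=> x _; rewrite lee_fin; case: ifP => // _.
  by rewrite !mulr_ge0 ?powR_ge0 ?expR_ge0.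
- by rewrite lee_fin invr_ge0 ltW.
apply: eq_integral => x _; rewrite /k/=.
case: ifPn => s0; last by rewrite integral0 mule0.
rewrite (@integral_if0r _ _ `[sqn x, +oo[); last first.
  by move=> u; rewrite in_itv/= andbT.
under eq_integral do rewrite EFinM.
rewrite ge0_integralZr//; last 3 first.
- by apply/measurable_EFinP; apply: measurable_funTS; exact: measurable_powR.
- by move=> s _; rewrite lee_fin powR_ge0.
- by rewrite lee_fin !mulr_ge0 ?powR_ge0 ?expR_ge0.
rewrite integral_powR_tail// -!EFinM; congr EFin.
rewrite powRD ?(gt_eqF s0) ?implybT// powRN.
by field; rewrite !gt_eqF ?powR_gt0.
Qed.

Let inner (u : R) : (\int[@lebesgue_tuple R d]_x (k (u, x))%:E =
  \int[@lebesgue_tuple R d]_x (k2 (u, x))%:E)%E.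
Proof.
have [u0|u0] := ltP 0 u; last first.
  rewrite !integral0_eq// => x _; rewrite /k /k2/= ?ltNge ?u0//=.
  by case: ifP => // s0; rewrite leNgt (le_lt_trans u0)// ltNge s0.
have r0 : 0 < Num.sqrt u by rewrite sqrtr_gt0.
have mku : measurable_fun setT (fun x => (k (u, x))%:E).
  apply/measurable_EFinP; apply: (measurableT_comp measurable_k).
  exact: measurable_pair1.
have H := integral_lebesgue_tuple_scale (f := fun x => (k (u, x))%:E)
  r0 (fun x => k_ge0 (u, x)) mku.
have -> : (\int[@lebesgue_tuple R d]_x (k (u, x))%:E = (Num.sqrt u ^+ d)%:E *
    \int[@lebesgue_tuple R d]_x (k (u, tscale (Num.sqrt u) x))%:E)%E.
  by rewrite H muleA -EFinM divff ?mul1e// expf_neq0// gt_eqF.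
rewrite -ge0_integralZl//; last 2 first.
- exact: (measurableT_comp mku (@measurable_tscale _ d (Num.sqrt u))).
- by move=> x _; exact: k_ge0.
apply: eq_integral => x _; rewrite -EFinM; congr EFin.
rewrite /k /k2/= u0 sqn_tscale (sqr_sqrtr (ltW u0)) (pmulr_rgt0 _ u0).
case: ifPn => s0/=; last by rewrite mulr0.
rewrite ger_pMr//; case: ifPn => s1; last by rewrite mulr0.
rewrite hg// powRM ?ltW// [sqn x * u]mulrC.
have -> : Num.sqrt u ^+ d = u `^ p.
  by rewrite -powR12_sqrt ?ltW// -powR_mulrn ?powR_ge0// -powRrM mulrC.
(* The three factors are the Jacobian, the weight in [u], and the scaling of [sqn x ^ (p + q)]. *)
have -> : u `^ (p + q - 1) = u `^ p * u `^ (- p - 1) * u `^ (p + q).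
  rewrite -!powRD ?(gt_eqF u0) ?implybT//; congr powR; ring.
ring.
Qed.

Let gamma_part : (\int[@lebesgue_tuple R d]_x \int[mu]_u (k2 (u, x))%:E =
  egamma (p + q) * \int[@lebesgue_tuple R d]_x
     (if (0 < sqn x <= 1)%R then g x else 0)%:E)%E.
Proof.
rewrite -ge0_integralZl//; last 3 first.
- apply/measurable_EFinP; apply: measurable_if0 => //.
  apply: measurable_and;
    [apply: measurable_fun_ltr|apply: measurable_fun_ler] => //;
  exact: measurable_sqn.
- by move=> x _; rewrite lee_fin; case: ifP.
- exact: egamma_ge0.
apply: eq_integral => x _; rewrite /k2/=.
case: ifPn => [/andP[s0 _]|_]; last first.
  by rewrite mule0 integral0_eq// => u _; case: ifP.
rewrite (@integral_if0r _ _ `]0, +oo[); last first.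
  by move=> u; rewrite in_itv/= andbT.
under eq_integral do rewrite EFinM.
rewrite ge0_integralZl//; last 3 first.
- apply/measurable_EFinP; apply: measurable_funTS; apply: measurable_funM.
    exact: measurable_powR.
  by do 2 apply: measurableT_comp => //; exact: measurable_funM.
- by move=> s _; rewrite lee_fin mulr_ge0 ?expR_ge0 ?powR_ge0.
- by rewrite lee_fin !mulr_ge0 ?powR_ge0 ?expR_ge0.
(* The weight [sqn x ^ (p + q)] was put into [k] to cancel the scale factor that appears here. *)
rewrite egamma_scale// muleA -EFinM muleC; congr (_ * _)%E; congr EFin.
by rewrite powRN mulfK// gt_eqF// powR_gt0.
Qed.

Lemma polar_gauss :
  (\int[@lebesgue_tuple R d]_x
     (if (0 < sqn x)%R then g x * sqn x `^ q * expR (- sqn x) else 0)%:E =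
   (d%:R / 2)%:E * (egamma (d%:R / 2 + q) * \int[@lebesgue_tuple R d]_x
     (if (0 < sqn x <= 1)%R then g x else 0)%:E))%E.
Proof.
have mk : measurable_fun setT (EFin \o k) by exact/measurable_EFinP.
have mk2 : measurable_fun setT (EFin \o k2) by exact/measurable_EFinP.
have := @fubini_tonelli _ _ _ _ R mu (@lebesgue_tuple R d) _ mk
  (fun z => k_ge0 z).
have := @fubini_tonelli _ _ _ _ R mu (@lebesgue_tuple R d) _ mk2
  (fun z => k2_ge0 z).
rewrite /= gamma_part gauss_part => <- E.
have -> : (\int[mu]_u \int[@lebesgue_tuple R d]_x (k2 (u, x))%:E =
    \int[mu]_u \int[@lebesgue_tuple R d]_x (k (u, x))%:E)%E.
  by apply: eq_integral => u _; rewrite inner.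
by rewrite E muleA -EFinM divff ?mul1e// gt_eqF.
Qed.

End identity.

End polar.

(** * Gaussian moments *)

Section gaussian_moments.
Context {R : realType}.
Local Notation mu := (@lebesgue_measure R).

Lemma integral_tuple_prod d (f : 'I_d -> R -> R) (c : 'I_d -> R) :
  (forall i x, 0 <= f i x) -> (forall i, measurable_fun setT (f i)) ->
  (forall i, (\int[mu]_x (f i x)%:E = (c i)%:E)%E) ->
  (\int[@lebesgue_tuple R d]_x (\prod_(i < d) f i (tnth x i))%:E =
   (\prod_(i < d) c i)%:E)%E.
Proof.
elim: d f c => [|d IH] f c f0 mf fc.
  rewrite integral_lebesgue_tuple0 ?big_ord0//.
    by move=> x; rewrite big_ord0 lee_fin.
  rewrite (_ : (fun x => _) = cst 1%E)//.
  by apply/funext => x; rewrite big_ord0.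
have mF n (h : 'I_n -> R -> R) : (forall i, measurable_fun setT (h i)) ->
    measurable_fun setT (fun x : n.-tuple R => \prod_(i < n) h i (tnth x i)).
  move=> mh; apply: measurable_prod => i _.
  by apply: (measurableT_comp (mh i)); exact: measurable_tnth.
rewrite integral_lebesgue_tupleS; last 2 first.
- by move=> x; rewrite lee_fin prodr_ge0.
- by apply/measurable_EFinP; exact: mF.
transitivity (\int[mu]_x ((f ord0 x)%:E * (\prod_(i < d) c (lift ord0
  i))%:E))%E.
  apply: eq_integral => x _.
  rewrite -(IH (fun i => f (lift ord0 i)) (fun i =>
    c (lift ord0 i)))// -ge0_integralZl//; last 3 first.
  - by apply/measurable_EFinP; exact: (mF _ (fun i => f (lift ord0 i))).
  - by move=> t _; rewrite lee_fin prodr_ge0.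
  - by rewrite lee_fin.
  apply: eq_integral => t _; rewrite big_ord_recl EFinM.
  by congr (_ * _%:E)%E; apply: eq_bigr => i _; rewrite tnthS.
have c0 i : 0 <= c i.
  by rewrite -lee_fin -fc; apply: integral_ge0 => x _; rewrite lee_fin.
rewrite ge0_integralZr//; last 3 first.
- by apply/measurable_EFinP; exact: mf.
- by move=> x _; rewrite lee_fin.
- by rewrite lee_fin prodr_ge0.
by rewrite fc -EFinM big_ord_recl.
Qed.

(** The integrand is a product over coordinates: those in [J] contribute 1, the [d - #|J|] others
    [sqrt pi]. *)
Lemma gauss_moment d (J : {set 'I_d}) :
  (\int[@lebesgue_tuple R d]_x
     (\prod_(j in J) `|tnth x j| * expR (- sqn x))%:E =
   (Num.sqrt pi ^+ (d - #|J|))%:E)%E.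
Proof.
pose f (i : 'I_d) (x : R) :=
  if i \in J then `|x| * expR (- x ^+ 2) else gauss_fun x.
pose c (i : 'I_d) : R := if i \in J then 1 else Num.sqrt pi.
transitivity (\int[@lebesgue_tuple R d]_x (\prod_(i < d) f i (tnth x i))%:E)%E.
  apply: eq_integral => x _; congr EFin.
  rewrite /sqn -sumrN expR_sum [in LHS]big_mkcond -big_split/=.
  apply: eq_bigr => i _; rewrite /f /gauss_fun; case: ifP => // _.
  by rewrite mul1r.
rewrite (@integral_tuple_prod _ _ c).
- congr EFin; rewrite (bigID (mem J))/= big1 ?mul1r; last first.
    by move=> i iJ; rewrite /c iJ.
  rewrite (eq_bigr (fun=> Num.sqrt pi)); last first.
    by move=> i /negbTE iJ; rewrite /c iJ.
  rewrite (eq_bigl (mem (~: J))) => [|i]; last by rewrite /= finset.in_setC.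
  by rewrite prodr_const cardsCs finset.setCK card_ord.
- move=> i x; rewrite /f; case: ifP => _; last exact: gauss_fun_ge0.
  by apply: mulr_ge0 => //; exact: expR_ge0.
- move=> i; rewrite /f; case: (i \in J); last exact: measurable_gauss_fun.
  apply: measurable_funM; last exact: measurable_gauss_fun.
  exact: normr_measurable.
- move=> i; rewrite /f /c; case: (i \in J); first exact: integral_abs_gauss.
  exact: integralT_gauss.
Qed.

(** The origin lies in the hyperplane where the first coordinate vanishes. In dimension 0 the
    measure is a Dirac mass and the claim is false. *)
Lemma negligible_sqn_eq0 d : (0 < d)%N ->
  (@lebesgue_tuple R d).-negligible [set x | sqn x = 0].
Proof.
case: d => // d _.
exists [set x | thead x = 0]; split.
- have := @measurable_tnth _ R d.+1 ord0 measurableT _ (measurable_set1 (0 :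
  R)).
  by rewrite setTI.
- transitivity ((mu \x @lebesgue_tuple R d)%E ([set (0:R)] `*` setT)).
    congr (product_measure1 _ _ _); apply/seteqP; split => -[x t]/=.
      by rewrite theadE.
    by rewrite theadE => -[].
  have E := product_measure1E mu (@lebesgue_tuple R d) (measurable_set1 (0 :
    R)) (@measurableT _ _).
  apply: (etrans E).
  exact: etrans (congr2 mule (lebesgue_measure_set1 0) erefl) (mul0e _).
- move=> x/= /eqP; rewrite psumr_eq0; last by move=> i _; exact: sqr_ge0.
  by move=> /allP/(_ ord0 (mem_index_enum _)); rewrite sqrf_eq0 => /eqP.
Qed.

Definition coord_prod d (J : {set 'I_d}) (x : d.-tuple R) : R :=
  \prod_(j in J) `|tnth x j|.

(** Extension of [coord_prod] from the sphere, homogeneous of degree 0: the product of the absolute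
    cosines of the angles between [x] and the axes in [J]. *)
Definition cosine_prod d (J : {set 'I_d}) (x : d.-tuple R) : R :=
  coord_prod J x / sqn x `^ (#|J|%:R / 2).

Lemma measurable_coord_prod d (J : {set 'I_d}) :
  measurable_fun setT (coord_prod J).
Proof.
rewrite (_ : coord_prod J = fun x : d.-tuple R =>
    \prod_j (if j \in J then `|tnth x j| else 1)); last first.
  by apply/funext => x; rewrite /coord_prod big_mkcond.
apply: measurable_prod => i _; case: (i \in J) => //.
by apply: measurableT_comp => //; exact: measurable_tnth.
Qed.

Lemma coord_prod_ge0 d (J : {set 'I_d}) x : 0 <= coord_prod J x.
Proof. by apply: prodr_ge0. Qed.

Lemma measurable_cosine_prod d (J : {set 'I_d}) :
  measurable_fun setT (cosine_prod J).
Proof.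
apply: measurable_funM; first exact: measurable_coord_prod.
rewrite (_ : (fun x => _) = fun x : d.-tuple R => sqn x `^ (- (#|J|%:R / 2))).
  by apply: (measurableT_comp (@measurable_powR R _)); exact: measurable_sqn.
by apply/funext => x; rewrite powRN.
Qed.

Lemma cosine_prod_ge0 d (J : {set 'I_d}) x : 0 <= cosine_prod J x.
Proof. by rewrite divr_ge0 ?coord_prod_ge0 ?powR_ge0. Qed.

Lemma coord_prod_tscale d (J : {set 'I_d}) r x : 0 < r ->
  coord_prod J (tscale r x) = r ^+ #|J| * coord_prod J x.
Proof.
move=> r0; rewrite /coord_prod -prodr_const -big_split/=.
by apply: eq_bigr => i _; rewrite tnth_mktuple normrM gtr0_norm.
Qed.

Lemma cosine_prod_tscale d (J : {set 'I_d}) r x : 0 < r ->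
  cosine_prod J (tscale r x) = cosine_prod J x.
Proof.
move=> r0; rewrite /cosine_prod coord_prod_tscale// sqn_tscale.
rewrite powRM ?sqr_ge0 ?sqn_ge0// -powR_mulrn ?ltW// -powRrM.
rewrite (_ : 2%:R * _ = #|J|%:R); last by field.
rewrite powR_mulrn ?ltW// -mulf_div divff ?mul1r//.
by rewrite expf_neq0// gt_eqF.
Qed.

(** For empty [J] this is the volume of the unit ball. *)
Definition cosine_integral d (J : {set 'I_d}) : \bar R :=
  (\int[@lebesgue_tuple R d]_x
     (if (0 < sqn x <= 1)%R then cosine_prod J x else 0)%:E)%E.

(** The polar identity with [q = #|J| / 2], chosen so that [cosine_prod J x * sqn x ^ q] is
    [coord_prod J x] off the origin, a null set. *)
Lemma cosine_integralE d (J : {set 'I_d}) : (0 < d)%N ->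
  ((Num.sqrt pi ^+ (d - #|J|))%:E = (d%:R / 2)%:E *
    (egamma (d%:R / 2 + #|J|%:R / 2) * cosine_integral J))%E.
Proof.
move=> d0; rewrite -(gauss_moment J).
rewrite -(@polar_gauss R d (cosine_prod J) (#|J|%:R / 2))//; last 3 first.
- exact: cosine_prod_ge0.
- exact: measurable_cosine_prod.
- by move=> r x; exact: cosine_prod_tscale.
apply: ae_eq_integral => //.
- apply/measurable_EFinP; apply: measurable_funM.
    exact: measurable_coord_prod.
  by do 2 apply: measurableT_comp => //; exact: measurable_sqn.
- apply/measurable_EFinP; apply: measurable_if0.
    by apply: measurable_fun_ltr => //; exact: measurable_sqn.
  apply: measurable_funM.
    apply: measurable_funM; first exact: measurable_cosine_prod.
    by apply: (measurableT_comp (@measurable_powR R _)); exact: measurable_sqn.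
  by do 2 apply: measurableT_comp => //; exact: measurable_sqn.
apply: negligibleS (negligible_sqn_eq0 d0) => x /=.
move=> /not_implyP[_]; apply: contra_notP => /eqP s0.
have {}s0 : 0 < sqn x by rewrite lt_neqAle eq_sym s0 sqn_ge0.
by rewrite s0 /cosine_prod divfK// gt_eqF// powR_gt0.
Qed.

End gaussian_moments.

(** * Finiteness and values of Gamma, closed form of the coefficients *)

Section gamma_values.
Context {R : realType}.
Local Notation mu := (@lebesgue_measure R).

Lemma egamma1 : @egamma R 1 = 1%E.
Proof.
rewrite /egamma.
under eq_integral do rewrite subrr powRr0 mul1r.
rewrite integral_itv_obnd_cbnd; last first.
  apply/measurable_EFinP; apply: measurable_funTS.
  by apply: measurableT_comp => //; exact: measurable_oppr.
have := @integral_expR_tail R 1 0 ltr01.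
rewrite mulr0 oppr0 expR0 divr1 => <-.
by apply: eq_integral => x _; rewrite mul1r.
Qed.

(** As [0 * +oo = 0], a finite positive product of nonnegative extended reals has no zero and no
    infinite factor. This yields the finiteness of Gamma without estimating its integral. *)
Lemma fin_pos_factors (x a : R) (g i : \bar R) : 0 < x -> 0 < a ->
  (0 <= g)%E -> (0 <= i)%E -> (x%:E = a%:E * (g * i))%E ->
  [/\ g = (fine g)%:E, i = (fine i)%:E, 0 < fine g & 0 < fine i].
Proof.
move=> x0 a0; case: g => [g| |]//; case: i => [i| |]//; rewrite ?lee_fin =>
  g0 i0.
- rewrite -!EFinM => -[E]; split => //=.
    by rewrite lt_neqAle g0 andbT; apply/eqP => h; move: x0;
      rewrite E -h mul0r mulr0 ltxx.
  by rewrite lt_neqAle i0 andbT; apply/eqP => h; move: x0;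
    rewrite E -h !mulr0 ltxx.
- have [->|gn0] := eqVneq g 0.
    by rewrite mul0e mule0 => -[E]; move: x0; rewrite E ltxx.
  by rewrite gt0_muley ?lte_fin ?lt_neqAle 1?eq_sym ?gn0// gt0_muley ?lte_fin.
- have [->|gn0] := eqVneq i 0.
    by rewrite mule0 mule0 => -[E]; move: x0; rewrite E ltxx.
  by rewrite gt0_mulye ?lte_fin ?lt_neqAle 1?eq_sym ?gn0// gt0_muley ?lte_fin.
- by rewrite mulyy gt0_muley ?lte_fin.
Qed.

Lemma cosine_integral_ge0 d (J : {set 'I_d}) : (0 <= @cosine_integral R d J)%E.
Proof.
by apply: integral_ge0 => x _; rewrite lee_fin; case: ifP => // _;
  exact: cosine_prod_ge0.
Qed.

Lemma cosine_integral_fin d (J : {set 'I_d}) : (0 < d)%N ->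
  let g := d%:R / 2 + #|J|%:R / 2 in
  [/\ @egamma R g = (Gamma g)%:E,
      @cosine_integral R d J = (fine (cosine_integral J))%:E,
      0 < Gamma g :> R & 0 < fine (@cosine_integral R d J)].
Proof.
move=> d0 g; apply: (fin_pos_factors _ _ (egamma_ge0 _)
  (cosine_integral_ge0 J) (cosine_integralE J d0)).
  by rewrite exprn_gt0// sqrtr_gt0 pi_gt0.
by rewrite divr_gt0// ltr0n.
Qed.

Lemma cosine_integral_fineE d (J : {set 'I_d}) : (0 < d)%N ->
  Num.sqrt pi ^+ (d - #|J|) = d%:R / 2 *
    (Gamma (d%:R / 2 + #|J|%:R / 2) * fine (@cosine_integral R d J)).
Proof.
move=> d0; have := @cosine_integralE R d J d0.
by have [-> -> _ _] := cosine_integral_fin J d0; rewrite -!EFinM => -[].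
Qed.

Lemma Gamma_half d : (0 < d)%N ->
  egamma (d%:R / 2) = (Gamma (d%:R / 2 : R))%:E /\ 0 < Gamma (d%:R / 2 : R).
Proof.
move=> d0; have := cosine_integral_fin (finset.set0 : {set 'I_d}) d0.
by rewrite cards0 mul0r addr0 => -[].
Qed.

Lemma GammaD1 (x : R) : 0 < x -> Gamma (x + 1) = x * Gamma x.
Proof.
move=> x0; rewrite !GammaE egammaD1//.
case: (egamma x) (egamma_ge0 x) => [r _|_|//]; first by [].
(* For an infinite Gamma integral both sides are 0, the value of [fine] at [+oo]. *)
by rewrite gt0_muley ?lte_fin//= mulr0.
Qed.

Lemma GammaDn (x : R) n : 0 < x ->
  Gamma (x + n%:R) = Gamma x * \prod_(0 <= k < n) (x + k%:R).
Proof.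
move=> x0; elim: n => [|n IH]; first by rewrite addr0 big_geq// mulr1.
rewrite -natr1 addrA GammaD1; last by rewrite ltr_wpDr.
by rewrite IH big_nat_recr//= mulrC mulrA.
Qed.

Lemma Gamma_nat n : Gamma (n.+1%:R : R) = n`!%:R.
Proof.
elim: n => [|n IH]; first by rewrite GammaE egamma1.
by rewrite -natr1 GammaD1 ?ltr0n// IH factS natrM.
Qed.

(** One formula for both cases of [h_coef]. If [n < d], the functional equation raises
    [Gamma ((d - n) / 2)] by [n], and the halves in its [n] factors absorb [2 ^+ n]. If [n = d],
    that Gamma would be taken at 0, but the sum of the two halves is [d] and [Gamma d] is
    [(d - 1)!]. *)
Lemma h_coefE d n : (0 < d)%N -> (n <= d)%N ->
  h_coef R d n =
  Gamma (d%:R / 2) / (Num.sqrt pi ^+ n * Gamma (d%:R / 2 + n%:R / 2)).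
Proof.
move=> d0; have pi0 : 0 <= pi :> R by exact: pi_ge0.
have sqrtpi m : pi `^ (m%:R / 2) = Num.sqrt pi ^+ m :> R.
  by rewrite mulrC powRrM powR12_sqrt// powR_mulrn// sqrtr_ge0.
rewrite leq_eqVlt /h_coef => /orP[/eqP->|nd].
  rewrite ltnn sqrtpi -mulrDl -mulr2n -[d%:R *+ 2]mulr_natr mulfK//.
  rewrite -[X in Gamma X%:R](prednK d0) Gamma_nat.
  by rewrite [_`!%:R * _]mulrC.
rewrite nd sqrtpi.
have x0 : 0 < ((d%:R - n%:R) / 2 : R).
  by rewrite divr_gt0// subr_gt0 ltr_nat.
have -> : d%:R / 2 + n%:R / 2 = (d%:R - n%:R) / 2 + n%:R :> R by field.
rewrite GammaDn//.
have -> : \prod_(0 <= k < n) (d%:R - n%:R + 2 * k%:R) =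
    2 ^+ n * \prod_(0 <= k < n) ((d%:R - n%:R) / 2 + k%:R) :> R.
  rewrite -[X in 2 ^+ X](subn0 n) -prodr_const_nat -big_split/=.
  by apply: eq_bigr => k _; field.
have p0 : \prod_(0 <= k < n) ((d%:R - n%:R) / 2 + k%:R) != 0 :> R.
  rewrite prodf_seq_neq0; apply/allP => k _ /=.
  by rewrite gt_eqF// ltr_wpDr.
have dn0 : (0 < d - n)%N by rewrite subn_gt0.
have [_] := Gamma_half dn0.
rewrite natrB ?(ltnW nd)// => G0.
by field; rewrite p0 !gt_eqF// ?exprn_gt0// sqrtr_gt0 pi_gt0.
Qed.

(** Quotient of [cosine_integral_fineE] at [J] and at the empty set: the factor [d / 2] cancels and
    [sqrt pi ^ #|J|] remains. *)
Lemma cosine_ratio d (J : {set 'I_d}) : (0 < d)%N ->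
  fine (cosine_integral J) / fine (cosine_integral (finset.set0 : {set 'I_d})) =
  h_coef R d #|J|.
Proof.
move=> d0; have Jd : (#|J| <= d)%N by rewrite -[X in (_ <= X)%N]card_ord
  max_card.
rewrite h_coefE//.
have [_ _ G0 I0] := cosine_integral_fin J d0.
have [_ _ G1 I1] := cosine_integral_fin (finset.set0 : {set 'I_d}) d0.
have E := cosine_integral_fineE J d0.
have := cosine_integral_fineE (finset.set0 : {set 'I_d}) d0.
rewrite cards0 mul0r addr0 subn0 in G1 *.
rewrite -[in LHS](subnKC Jd) exprD E => {}E.
have s0 : 0 < Num.sqrt pi ^+ #|J| :> R by rewrite exprn_gt0// sqrtr_gt0 pi_gt0.
have d2 : d%:R != 0 :> R by rewrite pnatr_eq0 -lt0n.
rewrite mulrCA in E.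
have {}E := mulfI (mulf_neq0 d2 (invr_neq0 (lt0r_neq0 (ltr0Sn R 1)))) E.
apply/eqP; rewrite eqr_div; last 2 first.
- exact: lt0r_neq0.
- by rewrite mulf_neq0// lt0r_neq0.
by apply/eqP; rewrite -E; ring.
Qed.

End gamma_values.

(** * The uniform law on the sphere *)

Lemma ge0_integral_mrestr d (T : measurableType d) (R : realType)
    (m : {measure set T -> \bar R}) (D : set T) (mD : measurable D)
    (f : T -> \bar R) :
  (forall x, 0 <= f x)%E -> measurable_fun setT f ->
  (\int[mrestr m mD]_x f x = \int[m]_(x in D) f x)%E.
Proof.
move=> f0 mf.
rewrite (@ge0_negligible_integral _ _ _ (mrestr m mD) setT (~` D))//=.
- rewrite setTD setCK; apply: eq_measure_integral => A mA AD.
  by rewrite /= /mrestr setIidl.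
- exact: measurableC.
- by rewrite /mrestr setICl measure0.
Qed.

Section uniform_sphere.
Context {R : realType} {disp : measure_display} {T : measurableType disp}.
Variables (P : probability T R) (d : nat) (U : T -> d.-tuple R).
Hypotheses (d0 : (0 < d)%N) (mU : measurable_fun setT U).
Hypothesis hU : uniform_on_sphere P U.

Definition normalize (x : d.-tuple R) : d.-tuple R :=
  tscale (Num.sqrt (sqn x))^-1 x.

Lemma measurable_normalize : measurable_fun setT normalize.
Proof.
apply/measurable_fun_tnthP => i.
rewrite (_ : _ \o _ = fun x => sqn x `^ (- 2^-1) * tnth x i).
  apply: measurable_funM; last exact: measurable_tnth.
  by apply: (measurableT_comp (@measurable_powR R _)); exact: measurable_sqn.
apply/funext => x /=; rewrite tnth_mktuple; congr (_ * _).
by rewrite powRN powR12_sqrt// sqn_ge0.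
Qed.

Definition punctured_ball : set (d.-tuple R) := [set x | 0 < sqn x <= 1].

Lemma measurable_punctured_ball : measurable punctured_ball.
Proof.
rewrite (_ : punctured_ball = setT `&` (@sqn R d) @^-1` `]0, 1]%classic).
  exact: (@measurable_sqn R d measurableT _ (measurable_itv `]0, 1])).
by apply/seteqP; split => x; rewrite /punctured_ball/= in_itv//= => -[].
Qed.

(** A point of the cone determines its radius, which is its norm, and its direction. The cone,
    defined as an image, thus becomes a preimage, to which measurability applies. *)
Lemma cone_sphere (A : set (d.-tuple R)) :
  cone (A `&` unit_sphere) = normalize @^-1` A `&` punctured_ball.
Proof.
apply/seteqP; split => [x [r /=]|x /= [Ax /andP[s0 s1]]].
  rewrite in_itv/= => /andP[r0 r1] [u [Au Su]] <-.
  have {}Su : sqn u = 1 by [].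
  have Er : sqn (tscale r u) = r ^+ 2 by rewrite sqn_tscale Su mulr1.
  split; rewrite /punctured_ball/=; last first.
    by rewrite -/(tscale r u) Er exprn_gt0//= expr_le1// ltW.
  rewrite /preimage/= -/(tscale r u) /normalize Er sqrtr_sqr gtr0_norm//.
  rewrite (_ : tscale _ _ = u)//; apply: eq_from_tnth => i.
  by rewrite !tnth_mktuple mulKf// gt_eqF.
have r0 : 0 < Num.sqrt (sqn x) by rewrite sqrtr_gt0.
exists (Num.sqrt (sqn x)).
  by rewrite /= in_itv/= r0/= -(sqrtr1 R) ler_sqrt.
exists (normalize x).
  split => //; rewrite /unit_sphere/= -/(sqn (normalize x)) sqn_tscale.
  by rewrite exprVn sqr_sqrtr ?ltW// mulVf// gt_eqF.
apply: eq_from_tnth => i.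
by rewrite !tnth_mktuple mulVKf// gt_eqF.
Qed.

Lemma surface_measureE (A : set (d.-tuple R)) :
  surface_measure A = (d%:R%:E *
    @lebesgue_tuple R d (normalize @^-1` A `&` punctured_ball))%E.
Proof. by rewrite /surface_measure cone_sphere. Qed.

Let V : R := fine (@cosine_integral R d finset.set0).

Let V0 : 0 < V.
Proof. by have [] := @cosine_integral_fin R d finset.set0 d0. Qed.

Lemma ball_volume : @lebesgue_tuple R d punctured_ball = V%:E.
Proof.
have [_ <- _ _] := @cosine_integral_fin R d finset.set0 d0.
rewrite /cosine_integral integral_if0.
transitivity (\int[@lebesgue_tuple R d]_(x in punctured_ball) 1)%E.
  by rewrite integral_cst ?mul1e//; exact: measurable_punctured_ball.
apply: eq_integral => x _.
by rewrite /cosine_prod /coord_prod big_set0 cards0 mul0r powRr0 divr1.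
Qed.

Lemma surface_sphere : surface_measure (@unit_sphere R d) = (d%:R * V)%:E.
Proof.
rewrite EFinM surface_measureE -ball_volume.
congr (_ * lebesgue_tuple _)%E.
apply/seteqP; split => [x []//|x /= /andP[s0 s1]]; split; last exact/andP.
rewrite /preimage /unit_sphere/= -/(sqn (normalize x)) sqn_tscale.
by rewrite exprVn sqr_sqrtr ?ltW// mulVf// gt_eqF.
Qed.

Lemma ge0_sphere_expectation (f : d.-tuple R -> \bar R) :
  (forall u, 0 <= f u)%E -> measurable_fun setT f ->
  (\int[P]_w f (U w) =
   V^-1%:E * \int[@lebesgue_tuple R d]_(x in punctured_ball) f (normalize x))%E.
Proof.
move=> f0 mf.
have V0' : 0 <= V^-1 by rewrite invr_ge0 ltW.
rewrite -(ge0_integral_image _ mU)//.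
transitivity (\int[mscale (NngNum V0') (image_measure
  (mrestr (@lebesgue_tuple R d) measurable_punctured_ball)
    measurable_normalize)]_u f u)%E.
  apply: eq_measure_integral => A mA _.
  rewrite /image_measure/= /pushforward hU// surface_sphere surface_measureE/=.
  rewrite muleA -EFinM /mscale/=; congr (_%:E * _)%E.
  (* The factor [d] of the surface measure cancels against that of the total area. *)
  by rewrite invfM mulrAC mulVf ?mul1r// pnatr_eq0 -lt0n.
rewrite ge0_integral_mscale//=; congr (_ * _)%E.
rewrite ge0_integral_image// ge0_integral_mrestr//.
by apply: (measurableT_comp mf); exact: measurable_normalize.
Qed.

Lemma measurable_unit_sphere : measurable (@unit_sphere R d).
Proof.
rewrite (_ : unit_sphere = setT `&` (@sqn R d) @^-1` [set 1]).
  exact: (@measurable_sqn R d measurableT _ (measurable_set1 1)).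
by rewrite setTI.
Qed.

Lemma sphere_ae : P (U @^-1` (~` unit_sphere)) = 0%E.
Proof.
rewrite hU; last by apply: measurableC; exact: measurable_unit_sphere.
rewrite /surface_measure setICl (_ : cone set0 = set0) ?measure0 ?mule0//.
by apply/seteqP; split => x // -[r _ [u []]].
Qed.

(** [coord_prod J] at [x / |x|] is [cosine_prod J x], so the expectation is the ratio computed in
    [cosine_ratio]. *)
Lemma abs_moment (J : {set 'I_d}) :
  (\int[P]_w (coord_prod J (U w))%:E = (h_coef R d #|J|)%:E)%E.
Proof.
rewrite (ge0_sphere_expectation (f := fun u => (coord_prod J u)%:E));
  last 2 first.
- by move=> u; rewrite lee_fin coord_prod_ge0.
- by apply/measurable_EFinP; exact: measurable_coord_prod.
rewrite -(cosine_ratio J d0) EFinM muleC.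
have [_ <- _ _] := @cosine_integral_fin R d J d0; congr (_ * _)%E.
rewrite /cosine_integral integral_if0.
apply: eq_integral => x; rewrite inE => /andP[s0 _]; congr EFin.
rewrite coord_prod_tscale ?invr_gt0 ?sqrtr_gt0// /cosine_prod mulrC.
congr (_ * _); rewrite exprVn; congr (_^-1).
by rewrite mulrC powRrM powR12_sqrt ?sqn_ge0// powR_mulrn// sqrtr_ge0.
Qed.

End uniform_sphere.

(** * Measurability of the number of intersections *)

(** Lower bounds on the number of points, for infinite sets too, become the existence of
    duplicate-free lists, which can later be sought among countably many. *)
Lemma le_counting (T : choiceType) (R : realType) (A : set T) n :
  (n%:R%:E <= counting A :> \bar R)%E <->
  exists s : seq T, [/\ size s = n, uniq s & {in s, forall x, A x}].
Proof.
rewrite /counting; case: asboolP => Af; last first.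
  split => [_|_]; last exact: leey.
  have [B BA nB] := infinite_set_fset n Af.
  exists (take n (finmap.enum_fset B)); split.
  - by rewrite size_takel.
  - by rewrite take_uniq// finmap.fset_uniq.
  - by move=> x /mem_take xB; exact: BA.
rewrite lee_fin ler_nat; split => [nA|[s [<- us sA]]].
  exists (take n (finmap.enum_fset (fset_set A))); split.
  - by rewrite size_takel.
  - by rewrite take_uniq// finmap.fset_uniq.
  - by move=> x /mem_take; rewrite in_fset_set// inE.
apply: uniq_leq_size => // x xs; rewrite in_fset_set// inE; exact: sA.
Qed.

Lemma measurable_uniq d (T : measurableType d) (I : Type) (U : eqType)
    (f : I -> T -> U) (r : seq I) :
  (forall i j, measurable [set t | f i t = f j t]) ->
  measurable [set t | uniq [seq f i t | i <- r]].
Proof.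
move=> mf.
have mem i (q : seq I) : measurable [set t | f i t \in [seq f j t | j <- q]].
  elim: q => [|j q IH].
    by rewrite (_ : [set _ | _] = set0)//; apply/seteqP; split.
  rewrite (_ : [set _ | _] = [set t | f i t = f j t] `|`
      [set t | f i t \in [seq f j t | j <- q]]); first exact: measurableU.
  apply/seteqP; split => t /=; rewrite in_cons.
    by move=> /orP[/eqP|]; [left|right].
  by move=> [->|->]; rewrite ?eqxx ?orbT.
elim: r => [|i r IH]; first by rewrite (_ : [set _ | _] = setT)//;
  apply/seteqP; split.
rewrite (_ : [set _ | _] = ~` [set t | f i t \in [seq f j t | j <- r]] `&`
    [set t | uniq [seq f i t | i <- r]]).
  by apply: measurableI => //; exact: measurableC.
apply/seteqP; split => t /=; first by move=> /andP[/negP].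
by move=> [/negP -> ->].
Qed.

(** Writing the inverse as [f * (f^2)^(-1)] reduces it to a real power of a nonnegative base; both
    sides are 0 where [f] vanishes. *)
Lemma measurable_funV d (T : measurableType d) (R : realType) (f : T -> R) :
  measurable_fun setT f -> measurable_fun setT (fun x => (f x)^-1).
Proof.
move=> mf; rewrite (_ : (fun x => _) = fun x => f x * (f x ^+ 2) `^ (-1)).
  apply: measurable_funM => //.
  by apply: (measurableT_comp (@measurable_powR R _)); exact: measurable_funX.
apply/funext => x; rewrite powR_inv1 ?sqr_ge0//.
have [->|fx] := eqVneq (f x) 0; first by rewrite invr0 mul0r.
by rewrite expr2 invfM mulVKf.
Qed.

Section grid_intersections.
Context {R : realType} {d : nat}.
Variables (tau l : R) (a : 'I_d -> R).
Hypothesis l0 : 0 < l.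

Definition needle_point (s : R) (z : d.-tuple R * d.-tuple R) : d.-tuple R :=
  [tuple tnth z.2 i + (s - tau) * l * tnth z.1 i | i < d].

(** A countable type, so that events can be written as countable unions over lists of indices. *)
Definition crossing_index := ('I_d * int + nat)%type.

(* Candidate parameters of intersection points. The left ones solve for the
   crossing of a given hyperplane; the right ones serve to find infinitely many
   points when the needle lies inside a hyperplane, and one when it is reduced
   to a point. *)
Definition crossing_param (j : crossing_index) (z : d.-tuple R * d.-tuple R) :
  R :=
  match j with
  | inl (i, k) => (k%:~R * a i - tnth z.2 i) / (l * tnth z.1 i) + tau
  | inr n => n.+1%:R^-1
  end.

Definition crossing_valid (j : crossing_index) (z : d.-tuple R * d.-tuple R) :=
  0 <= crossing_param j z <= 1 /\ grid a (needle_point (crossing_param j z) z).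

Let zt := (d.-tuple R * d.-tuple R)%type.

Lemma measurable_crossing_param j : measurable_fun setT (crossing_param j).
Proof.
case: j => [[i k]|n] /=; last exact: measurable_cst.
apply: measurable_funD => //; apply: measurable_funM.
  apply: measurable_funB => //.
  exact: (measurableT_comp (measurable_tnth i) measurable_snd).
apply: measurable_funV; apply: measurable_funM => //.
exact: (measurableT_comp (measurable_tnth i) measurable_fst).
Qed.

Lemma measurable_needle_point_coord (s : zt -> R) i : measurable_fun setT s ->
  measurable_fun setT (fun z => tnth (needle_point (s z) z) i).
Proof.
move=> ms.
rewrite (_ : (fun z => _) =
  fun z : zt => tnth z.2 i + (s z - tau) * l * tnth z.1 i); last first.
  by apply/funext => z; rewrite tnth_mktuple.
have m1 : measurable_fun setT (fun z : zt => tnth z.1 i).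
  by apply: (measurableT_comp (measurable_tnth i)).
have m2 : measurable_fun setT (fun z : zt => tnth z.2 i).
  by apply: (measurableT_comp (measurable_tnth i)).
apply: measurable_funD => //; apply: measurable_funM => //.
by apply: measurable_funM => //; exact: measurable_funB.
Qed.

Lemma measurable_eq_fun d' (T : measurableType d') (f g : T -> R) :
  measurable_fun setT f -> measurable_fun setT g ->
  measurable [set t | f t = g t].
Proof.
move=> mf mg.
rewrite (_ : [set t | _] = setT `&` (fun t => f t == g t) @^-1` [set true]).
  by apply: (measurable_fun_eqr mf mg).
by apply/seteqP; split => t /=; [move=> ->; rewrite eqxx|move=> [_ /eqP]].
Qed.

Lemma measurable_lattice d' (T : measurableType d') (f : T -> R) (c : R) :
  measurable_fun setT f -> measurable [set t | exists k : int, f t = k%:~R * c].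
Proof.
move=> mf.
rewrite (_ : [set t | _] = \bigcup_(k : int) [set t | f t = k%:~R * c]).
  by apply: countable_bigcupT_measurable => // k; exact: measurable_eq_fun.
by apply/seteqP; split => t /= [k]; [exists k|move=> _; exists k].
Qed.

Lemma measurable_grid_point (s : zt -> R) : measurable_fun setT s ->
  measurable [set z | grid a (needle_point (s z) z)].
Proof.
move=> ms.
rewrite (_ : [set z | _] = \bigcup_(i : 'I_d)
    [set z | exists k : int, tnth (needle_point (s z) z) i = k%:~R * a i]).
  apply: countable_bigcupT_measurable => // i.
  by apply: measurable_lattice; exact: measurable_needle_point_coord.
by apply/seteqP; split => z /= [i _ H]; exists i.
Qed.

Lemma measurable_crossing_valid j : measurable [set z | crossing_valid j z].
Proof.
apply: measurableI; last first.
  by apply: measurable_grid_point; exact: measurable_crossing_param.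
have := @measurable_crossing_param j measurableT _ (measurable_itv `[0, 1]).
rewrite setTI (_ : _ @^-1` _ = [set z | 0 <= crossing_param j z <= 1])//.
Qed.

Lemma needle_point_inj z : (exists i, tnth z.1 i != 0) ->
  injective (needle_point ^~ z).
Proof.
move=> [i ui] s s' /(congr1 (fun t => tnth t i)); rewrite !tnth_mktuple.
by move=> /addrI /(mulIf ui) /(mulIf (lt0r_neq0 l0)) /addIr.
Qed.

(** Every intersection point comes from a candidate, unless a nondegenerate needle lies in a
    hyperplane; then the parameters [1 / (j + 1)] give as many points as wanted. Uniqueness is
    required of the points, not of the indices, since distinct hyperplanes may cut the needle at one
    point. *)
Lemma crossing_points z n :
  (exists s : seq (d.-tuple R), [/\ size s = n, uniq s &
     {in s, forall y, (needle tau l z.2 z.1 `&` grid a) y}]) <->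
  (exists s : seq crossing_index, [/\ size s = n,
     uniq [seq needle_point (crossing_param j z) z | j <- s] &
     {in s, forall j, crossing_valid j z}]).
Proof.
split; last first.
  move=> [s [<- us sv]]; eexists; split; [|exact: us|]; first exact: size_map.
  move=> y /mapP[j js ->]; have [p01 pg] := sv j js; split => //.
  by exists (crossing_param j z); rewrite //= in_itv.
have lift (q : seq (d.-tuple R)) : uniq q ->
    {in q, forall y, exists2 j, crossing_valid j z &
      y = needle_point (crossing_param j z) z} ->
    exists s : seq crossing_index, [/\ size s = size q,
     uniq [seq needle_point (crossing_param j z) z | j <- s] &
     {in s, forall j, crossing_valid j z}].
  move=> uq qv.
  suff [s Es sv] : exists2 s : seq crossing_index,
      [seq needle_point (crossing_param j z) z | j <- s] = q &
      {in s, forall j, crossing_valid j z}.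
    by exists s; split => //; [rewrite -Es size_map|rewrite Es].
  elim: q qv {uq} => [|y q IH] qv; first by exists [::].
  have [|s <- sv] := IH; first by move=> x xq; apply: qv;
    rewrite in_cons xq orbT.
  have [j jv ->] := qv y (mem_head _ _).
  exists (j :: s) => // j'; rewrite in_cons => /predU1P[->//|]; exact: sv.
have [u0|/existsNP[i /eqP ui]] := pselect (forall i, tnth z.1 i = 0).
  have pt s : needle_point s z = z.2.
    by apply: eq_from_tnth => i; rewrite tnth_mktuple u0 mulr0 addr0.
  move=> [s [<- us sv]]; apply: lift => // y /sv [[r r01 <-] gr].
  rewrite -[X in grid a X]/(needle_point r z) pt in gr.
  (* [inr 0] has the admissible parameter 1, and with a zero direction all parameters give the same
     point. *)
  exists (inr 0%N); last by rewrite -[LHS]/(needle_point r z) !pt.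
  by split; rewrite /= ?invr1 ?ler01 ?lexx ?pt.
have inj : injective (needle_point ^~ z) by apply: needle_point_inj; exists i.
(* Either some hyperplane contains the whole needle, or every hyperplane met is met
   transversally. *)
have [[m [um [k xm]]]|nG] := pselect
    (exists m, tnth z.1 m = 0 /\ exists k : int, tnth z.2 m = k%:~R * a m).
  move=> _; exists [seq inr j | j <- iota 0 n]; split.
  - by rewrite size_map size_iota.
  - rewrite -map_comp map_inj_uniq ?iota_uniq// => j j' /inj /invr_inj.
    by move=> /eqP; rewrite eqr_nat => /eqP[].
  - move=> _ /mapP[j _ ->]; split.
      by rewrite /= invr_ge0 ler0n invf_le1 ?ltr0n// ler1n.
    exists m => //; exists k; by rewrite tnth_mktuple um mulr0 addr0.
move=> [s [<- us sv]]; apply: lift => // y /sv [[r r01 <-] gr].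
have [m _ [k ek]] := gr; rewrite tnth_mktuple in ek.
have um : tnth z.1 m != 0.
  apply/eqP => um; apply: nG; exists m; split => //; exists k.
  by rewrite -ek um mulr0 addr0.
have Er : crossing_param (inl (m, k)) z = r.
  rewrite /= -ek; field.
  by rewrite um gt_eqF.
exists (inl (m, k)); rewrite /crossing_valid Er//.
Qed.

(** The union runs over lists of indices, of which there are countably many, and each list imposes
    finitely many measurable conditions. *)
Lemma measurable_le_intersections n :
  measurable [set z : zt | (n%:R%:E <= intersections tau l a z.2 z.1)%E].
Proof.
rewrite (_ : [set z | _] = \bigcup_(s : seq crossing_index) [set z : zt |
   [/\ size s = n, uniq [seq needle_point (crossing_param j z) z | j <- s] &
     {in s, forall j, crossing_valid j z}]]); last first.
  apply/seteqP; split => z /=.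
    by move/le_counting/crossing_points => -[s sP]; exists s.
  by move=> [s _ sP]; apply/le_counting/crossing_points; exists s.
apply: countable_bigcupT_measurable => [|s]; first exact: countableP.
have [sn|sn] := eqVneq (size s) n; last first.
  rewrite (_ : [set z | _] = set0)//; apply/seteqP; split => z // [/eqP].
  by rewrite (negbTE sn).
rewrite (_ : [set z | _] =
   [set z | uniq [seq needle_point (crossing_param j z) z | j <- s]] `&`
   [set z | {in s, forall j, crossing_valid j z}]); last first.
  by apply/seteqP; split => z [].
apply: measurableI.
  apply: measurable_uniq => j j'.
  rewrite (_ : [set z | _] = ~` \bigcup_(i : 'I_d) ~` [set z |
      tnth (needle_point (crossing_param j z) z) i =
      tnth (needle_point (crossing_param j' z) z) i]).
    apply: measurableC; apply: countable_bigcupT_measurable => // i.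
    apply: measurableC.
    by apply: measurable_eq_fun; apply: measurable_needle_point_coord;
      exact: measurable_crossing_param.
  apply/seteqP; split => z /= E; first by case=> i _; apply; rewrite /= E.
  by apply: eq_from_tnth => i; apply: contrapT => ne; apply: E; exists i.
elim: s {sn} => [|j s IH].
  by rewrite (_ : [set z | _] = setT)//; apply/seteqP; split.
rewrite (_ : [set z | _] = [set z | crossing_valid j z] `&`
   [set z | {in s, forall j, crossing_valid j z}]).
  by apply: measurableI => //; exact: measurable_crossing_valid.
apply/seteqP; split => z /=.
  move=> H; split; first by apply: H; rewrite mem_head.
  by move=> j' js; apply: H; rewrite in_cons js orbT.
by move=> [H1 H2] j'; rewrite in_cons => /predU1P[->//|]; exact: H2.
Qed.

End grid_intersections.

(** * Crossing a family of hyperplanes *)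

Section crossing.
Context {R : realType}.
Local Notation mu := (@lebesgue_measure R).

(** The needle projected to one axis: [w] is the signed length of the projection, [c] the spacing of
    the hyperplanes, [x] the coordinate of the reference point. *)
Definition crosses (tau w c x : R) := exists s, 0 <= s <= 1 /\
  exists k : int, x + (s - tau) * w = k%:~R * c.

(** The projection is the interval from [x + p] to [x + p + |w|]; the minimum picks its left end for
    either sign of [w]. *)
Lemma crossesP (tau w c x : R) : let p := Num.min (- tau * w) ((1 - tau) * w) in
  crosses tau w c x <-> exists k : int, p <= k%:~R * c - x <= p + `|w|.
Proof.
move=> p.
have [w0|w0] := leP 0 w.
  have -> : p = - tau * w.
    by apply/min_idPl; rewrite ler_wpM2r//; lra.
  rewrite ger0_norm//; split.
    move=> [s [/andP[s0 s1] [k E]]]; exists k; rewrite -E; apply/andP; split;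
      nra.
  move=> [k /andP[k1 k2]]; have [w0'|w0'] := eqVneq w 0.
    exists 0; split; first by rewrite lexx ler01.
    by exists k; rewrite w0' !mulr0 in k1 k2 *; lra.
  have {}w0 : 0 < w by rewrite lt_neqAle eq_sym w0'.
  exists ((k%:~R * c - x) / w + tau); split; last by exists k; field.
  have -> : (k%:~R * c - x) / w + tau = (k%:~R * c - x + tau * w) / w by field.
  by rewrite ler_pdivlMr// ler_pdivrMr//; apply/andP; split; lra.
have -> : p = (1 - tau) * w.
  by apply/min_idPr; rewrite ler_wnM2r// ?ltW//; lra.
rewrite ltr0_norm//; split.
  by move=> [s [/andP[s0 s1] [k E]]]; exists k; rewrite -E; apply/andP; split;
    nra.
move=> [k /andP[k1 k2]]; have w0' : w != 0 by rewrite lt_eqF.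
exists ((k%:~R * c - x) / w + tau); split; last by exists k; field.
have -> : (k%:~R * c - x) / w + tau = (k%:~R * c - x + tau * w) / w by field.
by rewrite ler_ndivlMr// ler_ndivrMr//; apply/andP; split; lra.
Qed.

(** [E] consists of the translates by multiples of [c] of an interval of length [W <= c], so a
    period contains exactly one such length, possibly cut in two. *)
Lemma lebesgue_periodic (c p W : R) : 0 < c -> 0 <= W <= c ->
  let E := [set x : R | exists k : int, p <= k%:~R * c - x <= p + W] in
  measurable (E `&` `[0, c]%classic) /\ mu (E `&` `[0, c]%classic) = W%:E.
Proof.
move=> c0 /andP[W0 Wc] E.
(* With this [m], [q] is the representative in []0, c]] of the left ends [k * c - p - W]. *)
pose m : int := Num.floor ((p + W) / c) + 1.
pose q := m%:~R * c - p - W.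
have [q0 qc] : 0 < q /\ q <= c.
  have /andP[] := real_floor_itv (num_real ((p + W) / c)).
  by rewrite ler_pdivlMr// ltr_pdivrMr// /q /m !intrD; split; lra.
have {}EE x : E x <-> exists k : int, q <= x - k%:~R * c <= q + W.
  split=> -[k /andP[k1 k2]].
    by exists (k - m); rewrite /q intrB; apply/andP; split; lra.
  by exists (m + k); move: k1 k2; rewrite /q intrD => k1 k2; apply/andP;
    split; lra.
(* What linear arithmetic must be told about integrality: a nonzero multiple of [c] is at least [c]
   away from 0. *)
have kc (k : int) : (k%:~R * c >= c) \/ k = 0 \/ (k%:~R * c <= - c).
  have [k0|k0|->] := ltgtP k 0; last by right; left.
    by right; right; move: k0; rewrite -lezD1 -(ler_int R) intrD => k0; nra.
  by left; move: k0; rewrite -lezD1 add0r -(ler_int R) => k0; nra.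
have [qW|qW] := ltP (q + W) c.
  suff -> : E `&` `[0, c]%classic = `[q, q + W]%classic.
    split; first exact: measurable_itv.
    rewrite lebesgue_measure_itv/= lte_fin; case: ifPn => h.
      by rewrite -EFinB; congr EFin; lra.
    by congr EFin; move: h; rewrite -leNgt; lra.
  apply/seteqP; split => x /=.
    rewrite in_itv/= => -[/EE [k /andP[k1 k2]] /andP[x0 xc]].
    have [h|[h|h]] := kc k; [lra| |lra].
    by rewrite in_itv/=; rewrite h mul0r subr0 in k1 k2; rewrite k1 k2.
  rewrite !in_itv/= => /andP[x1 x2]; split; last by apply/andP; split; lra.
  by apply/EE; exists 0; rewrite mul0r subr0 x1.
(* The interval wraps around the end of the period, and only the gap between consecutive translates
   is missed. *)
have -> : E `&` `[0, c]%classic = `[0, c]%classic `\` `](q + W - c), q[%classic.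
  apply/seteqP; split => x /=.
    move=> [/EE [k /andP[k1 k2]] xc]; split => //.
    rewrite in_itv/= => /andP[x1 x2].
    by have [h|[h|h]] := kc k; [lra| rewrite h mul0r in k1; lra |lra].
  rewrite !in_itv/= => -[/andP[x0 xc] /negP]; rewrite negb_and -!leNgt.
  move=> xq; split; last by rewrite x0.
  apply/EE; case/orP: xq => xq.
    by exists (-1); rewrite mulN1r; apply/andP; split; lra.
  by exists 0; rewrite mul0r subr0; apply/andP; split; lra.
split; first by apply: measurableD; exact: measurable_itv.
rewrite measureD//=; last first.
  by rewrite lebesgue_measure_itv/= lte_fin; case: ifP => _; rewrite ?ltry.
rewrite setIidr; last first.
  move=> x /=; rewrite !in_itv/= => /andP[x1 x2]; apply/andP; split; lra.
rewrite !lebesgue_measure_itv/= !lte_fin c0.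
case: ifPn => h; first by rewrite -!EFinB; congr EFin; lra.
by rewrite sube0 -EFinB; congr EFin; move: h; rewrite -leNgt; lra.
Qed.

Lemma uniform_crosses (tau w c : R) (c0 : 0 < c) : `|w| <= c ->
  uniform_prob c0 [set x | crosses tau w c x] = (`|w| / c)%:E.
Proof.
move=> wc; pose p := Num.min (- tau * w) ((1 - tau) * w).
have [|mE E] := @lebesgue_periodic c p `|w| c0; first by rewrite normr_ge0.
rewrite /uniform_prob integral_uniform_pdf.
have -> : [set x | crosses tau w c x] =
    [set x : R | exists k : int, p <= k%:~R * c - x <= p + `|w|].
  by apply/seteqP; split => x /crossesP.
transitivity (\int[mu]_(x in [set x : R | exists k : int,
    (p <= k%:~R * c - x <= p + `|w|)%R] `&` `[0%R, c]%classic) (c^-1)%:E)%E.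
  apply: eq_integral => x; rewrite inE/= => -[_]; rewrite in_itv/= => xc.
  by rewrite /uniform_pdf xc subr0.
rewrite integral_cst//; apply: (etrans (congr1 (mule _) E)).
by rewrite -EFinM mulrC.
Qed.

Lemma uniform_prob_set1 (c : R) (c0 : 0 < c) (r : R) : uniform_prob c0 [set r]
  = 0%E.
Proof. by rewrite /uniform_prob integral_set1. Qed.

End crossing.

(** * Conditioning on one of two independent variables *)

Section independence.
Context {R : realType} {disp : measure_display} {T : measurableType disp}.
Variable P : probability T R.
Context d1 d2 (T1 : measurableType d1) (T2 : measurableType d2).
Variables (Y1 : {mfun T >-> T1}) (Y2 : {mfun T >-> T2}).

Lemma measurable_fun_section (E : set (T1 * T2)) : measurable E ->
  measurable_fun setT (fun w' => P [set w | E (Y1 w', Y2 w)]).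
Proof.
move=> mE.
have := measurable_fun_xsection (distribution P Y2) mE.
move=> /measurableT_comp => /(_ _ _ _ _ (@measurable_funPT _ _ _ _ Y1)).
congr measurable_fun; apply/funext => w' /=.
rewrite /distribution /pushforward; congr (P _).
by apply/seteqP; split => w /=; rewrite /xsection/= inE.
Qed.

(** The joint law agrees with the product of the marginals on rectangles, hence everywhere; its
    value on [E] is the integral of the sections. *)
Lemma independent_pair_prob (E : set (T1 * T2)) :
  (forall A B, measurable A -> measurable B ->
     P (Y1 @^-1` A `&` Y2 @^-1` B) = P (Y1 @^-1` A) * P (Y2 @^-1` B))%E ->
  measurable E ->
  (P [set w | E (Y1 w, Y2 w)] = \int[P]_w' P [set w | E (Y1 w', Y2 w)])%E.
Proof.
move=> ind mE.
have mY : measurable_fun setT (fun w => (Y1 w, Y2 w)).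
  by apply/measurable_fun_pairP; split; exact: measurable_funPT.
have := @product_measure_unique _ _ _ _ R (distribution P Y1)
  (distribution P Y2) (image_measure P mY).
move=> /(_ (fun A B mA mB => ind A B mA mB) E mE).
rewrite /product_measure1 [X in X = _](_ : _ =
  \int[P]_w' P [set w | E (Y1 w', Y2 w)])%E.
  by move=> ->.
rewrite ge0_integral_distribution//=; last first.
  exact: (measurable_fun_xsection (distribution P Y2) mE).
apply: eq_integral => w' _ /=.
rewrite /distribution /pushforward; congr (P _).
by apply/seteqP; split => w /=; rewrite /xsection/= inE.
Qed.

End independence.

(** * Intersection points versus crossed families *)

Section needle_geometry.
Context {R : realType} {d : nat}.
Variables (tau l : R) (a : 'I_d -> R).
Hypotheses (l0 : 0 < l) (a0 : forall i, 0 < a i) (la : forall i, l <= a i).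

Let zt := (d.-tuple R * d.-tuple R)%type.

Definition hits (z : zt) (i : 'I_d) : Prop :=
  crosses tau (l * tnth z.1 i) (a i) (tnth z.2 i).

Definition hit_set (z : zt) : {set 'I_d} := [set i | `[< hits z i >]]%SET.

(** Only the start [s = 0] is tested: a needle inside a hyperplane has its start there, and two
    hyperplanes of one family can be met only at the two ends. *)
Definition endpoint_on_grid (i : 'I_d) (z : zt) := exists k : int,
  tnth z.2 i - tau * (l * tnth z.1 i) = k%:~R * a i.

(** Equality of two crossing parameters, cross-multiplied. The condition on the [i]-th component
    makes the [j]-th coordinate of the position solvable from the [i]-th one. *)
Definition simultaneous (i j : 'I_d) (z : zt) := tnth z.1 i <> 0 /\
  exists k k' : int, (k%:~R * a i - tnth z.2 i) * tnth z.1 j =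
                     (k'%:~R * a j - tnth z.2 j) * tnth z.1 i.

Definition degenerate (z : zt) := (exists i, endpoint_on_grid i z) \/
  (exists i j, i != j /\ simultaneous i j z).

Lemma counting_eq (T : choiceType) (A : set T) n :
  (forall m, (m%:R%:E <= counting A :> \bar R)%E <-> (m <= n)%N) ->
  counting A = n%:R%:E :> \bar R.
Proof.
rewrite /counting; case: asboolP => _ H.
  congr (_%:R%:E); apply/eqP; rewrite eqn_leq; apply/andP; split.
    by apply/H; rewrite lexx.
  by rewrite -(ler_nat R) -lee_fin; apply/H.
by have /H := leey (n.+1%:R%:E : \bar R); rewrite ltnn.
Qed.

Lemma sphere_coord_le1 (u : d.-tuple R) i : unit_sphere u -> `|tnth u i| <= 1.
Proof.
rewrite /unit_sphere/= (bigD1 i)//= => E.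
rewrite -(@expr_le1 _ 2)// real_normK ?num_real// -E lerDl.
by apply: sumr_ge0 => j _; exact: sqr_ge0.
Qed.

(** Outside the degenerate set a crossed family [i] has a single crossing parameter [s i], and the
    corresponding points are distinct for distinct families. *)
Lemma intersections_generic (z : zt) : unit_sphere z.1 -> ~ degenerate z ->
  intersections tau l a z.2 z.1 = #|hit_set z|%:R%:E.
Proof.
move=> Sz gz.
have ge i : ~ endpoint_on_grid i z by move=> h; apply: gz; left; exists i.
have gs i j : i != j -> ~ simultaneous i j z.
  by move=> ij h; apply: gz; right; exists i, j.
have hitP i : i \in hit_set z <-> hits z i.
  by rewrite inE; split => [/asboolP|h]//; exact/asboolP.
have nz i : hits z i -> tnth z.1 i <> 0.
  move=> [s [_ [k E]]] u0; apply: (ge i); exists k.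
  by rewrite -E u0 !mulr0 subr0 addr0.
pose s i : R := if pselect (hits z i) is left h then projT1 (cid h) else 0.
have sP i : hits z i -> 0 <= s i <= 1 /\ exists k : int,
    tnth z.2 i + (s i - tau) * (l * tnth z.1 i) = k%:~R * a i.
  by move=> h; rewrite /s; case: pselect => // h'; exact: (projT2 (cid h')).
have suniq i s' (k' : int) : 0 <= s' <= 1 ->
    tnth z.2 i + (s' - tau) * (l * tnth z.1 i) = k'%:~R * a i -> s' = s i.
  move=> s'01 E'; have hi : hits z i by exists s'; split => //; exists k'.
  have [s01 [k E]] := sP i hi.
  have u1 := sphere_coord_le1 i Sz.
  have lu : `|l * tnth z.1 i| <= a i.
    rewrite normrM gtr0_norm//; apply: le_trans (la i).
    by rewrite ler_piMr// ltW.
  have Ed : (s' - s i) * (l * tnth z.1 i) = (k' - k)%:~R * a i.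
    by rewrite intrB [RHS]mulrBl -E -E'; ring.
  have [ekk|nkk] := eqVneq k' k.
    move: Ed; rewrite ekk subrr mul0r => /eqP; rewrite !mulf_eq0 (gt_eqF l0)//=.
    by rewrite subr_eq0 => /orP[/eqP//|/eqP/(nz _ hi)].
  exfalso.
  have k1 : 1 <= `|(k' - k)%:~R| :> R.
    rewrite -intr_norm -[1]/(1%:~R) ler_int; move: nkk; rewrite -subr_eq0.
    by rewrite -normr_gt0 -lezD1 add0r.
  have nE : `|s' - s i| * `|l * tnth z.1 i| = `|(k' - k)%:~R| * a i.
    by rewrite -normrM Ed normrM (gtr0_norm (a0 i)).
  have sd : `|s' - s i| <= 1.
    by rewrite ler_norml; move: s01 s'01 => /andP[? ?] /andP[? ?]; apply/andP;
      split; lra.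
  (* The product of [|s' - s i|] and [|l * u_i|] is at least [a i], while the second factor is at
     most [a i]. *)
  have sd1 : 1 <= `|s' - s i|.
    have ai := a0 i; have := normr_ge0 (l * tnth z.1 i).
    have := normr_ge0 (s' - s i); nra.
  (* Two points of [[0, 1]] at distance at least 1 are its ends, so the start is on the grid. *)
  have [s0|s0] : s' = 0 \/ s i = 0.
  - move: sd1 s01 s'01 => + /andP[? ?] /andP[? ?].
    by have [h|h] := leP 0 (s' - s i);
      [rewrite ger0_norm//|rewrite ltr0_norm//];
      move=> ?; [right|left]; lra.
  - by apply: (ge i); exists k'; rewrite -E' s0; ring.
  - by apply: (ge i); exists k; rewrite -E s0; ring.
have tE i s' : tnth (needle_point tau l s' z) i =
    tnth z.2 i + (s' - tau) * (l * tnth z.1 i).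
  by rewrite tnth_mktuple mulrA.
pose f i := needle_point tau l (s i) z.
have finj : {in hit_set z &, injective f}.
  move=> i j /hitP hi /hitP hj /(congr1 (fun t => tnth t i)).
  rewrite /f !tE => /addrI /(mulIf (mulf_neq0 (lt0r_neq0 l0) _)) H.
  have {}H : s i = s j by apply: addIr; apply: H; apply/eqP; exact: nz.
  have [//|ij] := eqVneq i j; exfalso; apply: (gs _ _ ij); split;
    first exact: nz.
  have [_ [k E]] := sP i hi; have [_ [k' E']] := sP j hj.
  by exists k, k'; rewrite -E -E' H; ring.
have uf : uniq [seq f i | i <- enum (hit_set z)].
  rewrite map_inj_in_uniq ?enum_uniq// => i j.
  by rewrite !mem_enum; exact: finj.
have onf y : (needle tau l z.2 z.1 `&` grid a) y <->
    y \in [seq f i | i <- enum (hit_set z)].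
  split.
    move=> [[r]]; rewrite /= in_itv/= => r01 <-.
    rewrite -[X in X \in _]/(needle_point tau l r z) -[X in grid a
      X]/(needle_point tau l r z).
    move=> [i _ [k]]; rewrite tE => E.
    have -> := suniq i r k r01 E.
    apply: (map_f f); rewrite mem_enum; apply/hitP.
    by exists r; split => //; exists k.
  move=> /mapP[i]; rewrite mem_enum => /hitP hi ->.
  have [s01 [k E]] := sP i hi; split; first by exists (s i); rewrite //= in_itv.
  by exists i => //; exists k; rewrite tE.
apply: counting_eq => m; split.
  move/le_counting => [q [<- uq qP]].
  have <- : size [seq f i | i <- enum (hit_set z)] = #|hit_set z|.
    by rewrite size_map cardE.
  by apply: uniq_leq_size => // y /qP /onf.
move=> mn; apply/le_counting;
  exists (take m [seq f i | i <- enum (hit_set z)]); split.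
- by rewrite size_takel// size_map -cardE.
- exact: take_uniq.
- by move=> y /mem_take /onf.
Qed.

Let measurable_u i : measurable_fun setT (fun z : zt => tnth z.1 i).
Proof. exact: (measurableT_comp (measurable_tnth i) measurable_fst). Qed.

Let measurable_x i : measurable_fun setT (fun z : zt => tnth z.2 i).
Proof. exact: (measurableT_comp (measurable_tnth i) measurable_snd). Qed.

Lemma measurable_endpoint i : measurable [set z | endpoint_on_grid i z].
Proof.
apply: measurable_lattice; apply: measurable_funB => //.
by do 2 apply: measurable_funM => //.
Qed.

Lemma measurable_simultaneous i j : measurable [set z | simultaneous i j z].
Proof.
rewrite (_ : [set z | _] = ~` [set z | tnth z.1 i = 0] `&`
  \bigcup_(k : int * int) [set z : zt |
    (k.1%:~R * a i - tnth z.2 i) * tnth z.1 j =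
    (k.2%:~R * a j - tnth z.2 j) * tnth z.1 i]).
  apply: measurableI.
    by apply: measurableC; exact: measurable_eq_fun.
  apply: countable_bigcupT_measurable => // k.
  by apply: measurable_eq_fun; apply: measurable_funM => //;
    exact: measurable_funB.
apply/seteqP; split => z /= [u0 [k]].
  by move=> [k' E]; split => //; exists (k, k').
by move=> _ E; split => //; exists k.1, k.2.
Qed.

Lemma measurable_degenerate : measurable [set z | degenerate z].
Proof.
rewrite (_ : [set z | _] =
  (\bigcup_(i : 'I_d) [set z | endpoint_on_grid i z]) `|`
  \bigcup_(k : 'I_d * 'I_d) [set z | k.1 != k.2 /\ simultaneous k.1 k.2 z]).
  apply: measurableU; apply: countable_bigcupT_measurable => // k.
    exact: measurable_endpoint.
  have [_|_] := eqVneq k.1 k.2.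
    by rewrite (_ : [set _ | _] = set0)//; apply/seteqP; split => // z [].
  rewrite (_ : [set _ | _] = [set z | simultaneous k.1 k.2 z]).
    exact: measurable_simultaneous.
  by apply/seteqP; split => // z [].
apply/seteqP; split => z /=.
  by move=> [[i h]|[i [j [ij h]]]]; [left; exists i|right; exists (i, j)].
by move=> [[i _ h]|[[i j] _ [ij h]]]; [left; exists i|right; exists i, j].
Qed.

(** [crossesP] trades the real parameter for an integer, so the union is countable. *)
Lemma measurable_crosses d' (T : measurableType d') (w x : T -> R) (c : R) :
  measurable_fun setT w -> measurable_fun setT x ->
  measurable [set t | crosses tau (w t) c (x t)].
Proof.
move=> mw mx.
pose p t := Num.min (- tau * w t) ((1 - tau) * w t).
have mp : measurable_fun setT p.
  by apply: measurable_minr; apply: measurable_funM.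
rewrite (_ : [set t | _] = \bigcup_(k : int) (setT `&`
    (fun t => (p t <= k%:~R * c - x t) && (k%:~R * c - x t <= p t + `|w t|))
      @^-1` [set true])).
  apply: countable_bigcupT_measurable => // k.
  apply: measurable_and => //; apply: measurable_fun_ler => //.
  - exact: measurable_funB.
  - exact: measurable_funB.
  - by apply: measurable_funD => //; exact: measurableT_comp.
apply/seteqP; split => t /=.
  by move=> /crossesP[k h]; exists k.
by move=> [k _ [_ h]]; apply/crossesP; exists k.
Qed.

Lemma measurable_hits i : measurable [set z | hits z i].
Proof. by apply: measurable_crosses => //; exact: measurable_funM. Qed.

Lemma measurable_all_hits (J : {set 'I_d}) :
  measurable [set z | forall j, j \in J -> hits z j].
Proof.
rewrite (_ : [set z | _] =
    ~` \bigcup_(j : 'I_d) [set z | j \in J /\ ~ hits z j]).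
  apply: measurableC; apply: countable_bigcupT_measurable => // j.
  have [jJ|jJ] := boolP (j \in J).
    rewrite (_ : [set z | _] = ~` [set z | hits z j]).
      by apply: measurableC; exact: measurable_hits.
    by apply/seteqP; split => z //= [].
  by rewrite (_ : [set _ | _] = set0)//; apply/seteqP; split => z // [].
apply/seteqP; split => z /= H; first by move=> [j _ [jJ]]; apply; exact: H.
by move=> j jJ; apply: contrapT => nh; apply: H; exists j.
Qed.

End needle_geometry.

(** * Crossing probabilities *)

Lemma null_bigcup d (T : measurableType d) (R : realType)
    (P : {measure set T -> \bar R}) (I : countType) (F : I -> set T) :
  (forall i, measurable (F i)) -> (forall i, P (F i) = 0%E) ->
  P (\bigcup_i F i) = 0%E.
Proof.
move=> mF F0; apply: measure_negligible.
  exact: countable_bigcupT_measurable.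
pose G n := oapp F set0 (unpickle n).
apply: (@negligibleS _ _ _ P (\bigcup_n G n)); last first.
  apply: negligible_bigcup => n; rewrite /G; case: unpickle => [i|] /=.
    by exists (F i); split.
  exact: negligible_set0.
by move=> t [i _ Fi]; exists (pickle i) => //; rewrite /G pickleK.
Qed.

Section needle_probability.
Context {R : realType} {disp : measure_display} {T : measurableType disp}.
Variables (P : probability T R) (d : nat) (tau l : R) (a : 'I_d -> R).
Hypotheses (d0 : (0 < d)%N) (l0 : 0 < l) (a0 : forall i, 0 < a i).
Hypothesis la : forall i, l <= a i.
Variables X U : {mfun T >-> d.-tuple R}.
Hypotheses (hX : uniform_on_box P a0 X) (hU : uniform_on_sphere P U).
Hypothesis hXU : independent_vectors P X U.

Let mX i : measurable_fun setT (fun w => tnth (X w) i).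
Proof. exact: (measurableT_comp (measurable_tnth i) (@measurable_funPT _ _ _ _
  X)). Qed.

Let ind A B : measurable A -> measurable B ->
  P (U @^-1` A `&` X @^-1` B) = (P (U @^-1` A) * P (X @^-1` B))%E.
Proof. by move=> mA mB; rewrite setIC hXU// muleC. Qed.

Lemma box_coord_set1 i (r : R) : P [set w | tnth (X w) i = r] = 0%E.
Proof.
rewrite -(uniform_prob_set1 (a0 i) r); exact: (hX.2 i _ (measurable_set1 r)).
Qed.

Lemma endpoint_null i u : P [set w | endpoint_on_grid tau l a i (u, X w)] = 0%E.
Proof.
rewrite (_ : [set w | _] = \bigcup_(k : int)
   [set w | tnth (X w) i = k%:~R * a i + tau * (l * tnth u i)]); last first.
  apply/seteqP; split => w /=.
    by move=> [k E]; exists k => //=; rewrite -E subrK.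
  by move=> [k _ /= E]; exists k; rewrite /= E addrK.
apply: null_bigcup => k; last exact: box_coord_set1.
exact: measurable_eq_fun.
Qed.

(** [X_i] and [X_j] are independent; once [X_i] is frozen, division by the nonzero [u_i] leaves
    countably many values for [X_j], each of probability 0. *)
Lemma simultaneous_null i j u : i != j ->
  P [set w | simultaneous a i j (u, X w)] = 0%E.
Proof.
move=> ij.
have [u0|u0] := eqVneq (tnth u i) 0.
  rewrite (_ : [set w | _] = set0) ?measure0//.
  by apply/seteqP; split => // w [].
have [mi mj] := (mX i, mX j).
pose pi_ := isMeasurableFun.Build _ _ _ _ _ mi.
pose pj_ := isMeasurableFun.Build _ _ _ _ _ mj.
pose Xi : {mfun T >-> R} := HB.pack (fun w => tnth (X w) i) pi_.
pose Xj : {mfun T >-> R} := HB.pack (fun w => tnth (X w) j) pj_.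
pose E := [set y : R * R | exists k k' : int,
  (k%:~R * a i - y.1) * tnth u j = (k'%:~R * a j - y.2) * tnth u i].
have mE : measurable E.
  rewrite (_ : E = \bigcup_(k : int * int) [set y : R * R |
    (k.1%:~R * a i - y.1) * tnth u j = (k.2%:~R * a j - y.2) * tnth u i]).
    apply: countable_bigcupT_measurable => // k.
    by apply: measurable_eq_fun; apply: measurable_funM => //;
      exact: measurable_funB.
  apply/seteqP; split => y /= [k].
    by move=> [k' e]; exists (k, k').
  by move=> _ e; exists k.1, k.2.
rewrite (_ : [set w | _] = [set w | E (Xi w, Xj w)]); last first.
  by apply/seteqP; split => w /= => [[]|e]//; split => //; exact/eqP.
rewrite independent_pair_prob//; last first.
  move=> A B mA mB.
  pose C (m : 'I_d) : set R := if m == i then A else B.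
  have mC m : measurable (C m) by rewrite /C; case: ifP.
  have := hX.1 [set i; j]%SET C mC.
  rewrite big_setU1 ?finset.in_set1//= finset.big_set1 /C eqxx eq_sym (negbTE
    ij) => <-.
  congr (P _); apply/seteqP; split => w /=.
    move=> [Aw Bw] m /=; rewrite finset.in_set2 => /orP[]/eqP->;
      rewrite /C ?eqxx//.
    by rewrite eq_sym (negbTE ij).
  move=> H; split.
    by have := H i; rewrite /C eqxx; apply; rewrite /= finset.set21.
  have := H j; rewrite /C eq_sym (negbTE ij); apply; by rewrite /= finset.set22.
rewrite integral0_eq// => w' _.
rewrite (_ : [set w | _] = \bigcup_(k : int * int) [set w | tnth (X w) j =
   k.2%:~R * a j - (k.1%:~R * a i - Xi w') * tnth u j / tnth u i]).
  apply: null_bigcup => k; last exact: box_coord_set1.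
  exact: measurable_eq_fun.
apply/seteqP; split => w /= [k].
  move=> [k' e]; exists (k, k') => //=.
  by rewrite e mulfK//; rewrite opprB addrC subrK.
move=> _ /= e; exists k.1, k.2 => /=.
by rewrite e subKr divfK.
Qed.

Lemma degenerate_null : P [set w | degenerate tau l a (U w, X w)] = 0%E.
Proof.
rewrite (independent_pair_prob ind (measurable_degenerate tau l a)).
rewrite integral0_eq// => w' _.
have mdeg (E : set (d.-tuple R * d.-tuple R)) : measurable E ->
    measurable [set w | E (U w', X w)].
  move=> mE; have : measurable_fun setT (fun w => (U w', X w)).
    by apply/measurable_fun_pairP; split;
      [exact: measurable_cst|exact: (@measurable_funPT _ _ _ _ X)].
  by move=> /(_ measurableT _ mE); rewrite setTI.
rewrite (_ : [set w | _] =
  (\bigcup_(i : 'I_d) [set w | endpoint_on_grid tau l a i (U w', X w)]) `|`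
  \bigcup_(k : 'I_d * 'I_d) [set w | k.1 != k.2 /\
    simultaneous a k.1 k.2 (U w', X w)]); last first.
  apply/seteqP; split => w /=.
    by move=> [[i h]|[i [j [ij h]]]]; [left; exists i|right; exists (i, j)].
  by move=> [[i _ h]|[[i j] _ [ij h]]]; [left; exists i|right; exists i, j].
have ms (k : 'I_d * 'I_d) : measurable [set w | k.1 != k.2 /\
    simultaneous a k.1 k.2 (U w', X w)].
  have [_|_] := eqVneq k.1 k.2.
    by rewrite (_ : [set _ | _] = set0)//; apply/seteqP; split => // w [].
  rewrite (_ : [set _ | _] = [set w | simultaneous a k.1 k.2 (U w', X w)]).
    exact: (mdeg _ (measurable_simultaneous a k.1 k.2)).
  by apply/seteqP; split => // w [].
have me i : measurable [set w | endpoint_on_grid tau l a i (U w', X w)].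
  exact: (mdeg _ (measurable_endpoint tau l a i)).
have md : P (\bigcup_(k : 'I_d * 'I_d) [set w | k.1 != k.2 /\
    simultaneous a k.1 k.2 (U w', X w)]) = 0%E.
  apply: null_bigcup => // k; have [_|ij] := eqVneq k.1 k.2.
    by rewrite (_ : [set _ | _] = set0) ?measure0//; apply/seteqP; split =>
      // w [].
  rewrite -[RHS](simultaneous_null (U w') ij); congr (P _).
  by apply/seteqP; split => // w [].
rewrite measureU0//.
- by apply: null_bigcup => // i; exact: endpoint_null.
- exact: countable_bigcupT_measurable.
- exact: countable_bigcupT_measurable.
Qed.

Lemma box_all_hits (J : {set 'I_d}) u : unit_sphere u ->
  P [set w | forall j, j \in J -> hits tau l a (u, X w) j] =
  (\prod_(j in J) (l / a j) * coord_prod J u)%:E.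
Proof.
move=> Su.
pose B (j : 'I_d) : set R := [set x | crosses tau (l * tnth u j) (a j) x].
have mB j : measurable (B j).
  exact: (@measurable_crosses R tau _ R (fun=> l * tnth u j) id).
have := hX.1 J B mB.
rewrite (_ : \bigcap_(i in [set` J]) _ =
  [set w | forall j, j \in J -> hits tau l a (u, X w) j]); last first.
  by apply/seteqP; split => w H j /=; [exact: (H j)|exact: (H j)].
move=> ->.
rewrite /coord_prod -big_split/= -prodEFin.
apply: eq_bigr => j _; transitivity (uniform_prob (a0 j) (B j)).
  by rewrite -hX.2.
rewrite uniform_crosses; last first.
  rewrite normrM gtr0_norm//; apply: le_trans (la j).
  by rewrite ler_piMr //; [exact: ltW|exact: sphere_coord_le1].
by rewrite normrM gtr0_norm// mulrAC.
Qed.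

Definition needle_hits w : {set 'I_d} := hit_set tau l a (U w, X w).

Lemma measurable_needle_all_hits (J : {set 'I_d}) :
  measurable [set w | J \subset needle_hits w].
Proof.
have mY : measurable_fun setT (fun w => (U w, X w)).
  by apply/measurable_fun_pairP; split; exact: measurable_funPT.
have := mY measurableT _ (measurable_all_hits tau l a J).
rewrite setTI; congr measurable; apply/seteqP; split => w /=.
  by move=> H; apply/fintype.subsetP => j /H h; rewrite inE; exact/asboolP.
by move=> /fintype.subsetP H j /H; rewrite inE => /asboolP.
Qed.

Lemma needle_all_hits (J : {set 'I_d}) :
  P [set w | J \subset needle_hits w] =
  (\prod_(j in J) (l / a j) * h_coef R d #|J|)%:E.
Proof.
have mE := measurable_all_hits tau l a J.
transitivity (P [set w | forall j, j \in J -> hits tau l a (U w, X w) j]).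
  congr (P _); apply/seteqP; split => w /=.
    by move=> /fintype.subsetP H j /H; rewrite inE => /asboolP.
  by move=> H; apply/fintype.subsetP => j /H h; rewrite inE; exact/asboolP.
rewrite (independent_pair_prob ind mE).
transitivity (\int[P]_w ((\prod_(j in J) (l / a j))%:E *
    (coord_prod J (U w))%:E))%E.
  apply: ae_eq_integral => //.
  - exact: (measurable_fun_section P U X mE).
  - apply/measurable_EFinP; apply: measurable_funM => //.
    exact: (measurableT_comp (@measurable_coord_prod R d J)).
  (* The formula for a fixed direction relies on [|u_j| <= 1]; [U] leaves the sphere with
     probability 0. *)
  - exists (U @^-1` (~` @unit_sphere R d)); split.
    + rewrite -[X in measurable X]setTI; apply: measurable_funPT => //.
      by apply: measurableC; exact: measurable_unit_sphere.
    + exact: sphere_ae.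
    + move=> w /= H Sw; apply: H => _; rewrite -EFinM.
      exact: box_all_hits.
rewrite ge0_integralZl//; last 3 first.
- apply/measurable_EFinP.
  exact: (measurableT_comp (@measurable_coord_prod R d J)).
- by move=> w _; rewrite lee_fin coord_prod_ge0.
- by rewrite lee_fin; apply: prodr_ge0 => j _; rewrite divr_ge0// ltW.
by rewrite abs_moment//; exact: measurable_funPT.
Qed.

End needle_probability.

(** * Binomial moments *)

Lemma elem_symE (R : realType) d n (lam : 'I_d -> R) :
  elem_sym n lam = \sum_(J : {set 'I_d} | #|J| == n) \prod_(j in J) lam j.
Proof.
rewrite /elem_sym /mpoly.mesym.
rewrite (big_morph _ (mpoly.mevalD lam) (mpoly.meval0 lam)).
apply: eq_bigr => J _.
rewrite (big_morph _ (mpoly.mevalM lam) (mpoly.meval1 lam)).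
by apply: eq_bigr => j _; exact: mpoly.mevalXU.
Qed.

(** Inversion of the Pascal matrix, by Pascal's rule on ['C(N, n)] and then on ['C(n, i)]. The free
    bound [M] lets the sum run up to [d] for every number [N <= d] of crossed families. *)
Lemma binomial_orthogonality (R : comRingType) (N M i : nat) : (N < M)%N ->
  \sum_(n < M) (-1) ^+ (i + n) * 'C(n, i)%:R * 'C(N, n)%:R = (N == i)%:R :> R.
Proof.
elim: N i M => [|N IH] i [//|M] NM.
  rewrite big_ord_recl big1 ?addr0; last by move=> n _; rewrite bin0n mulr0.
  by rewrite !bin0n addn0 mulr1; case: i => [|i]; rewrite ?mulr1 ?mulr0.
have S : \sum_(n < M.+1) (-1) ^+ (i + n) * 'C(n, i)%:R * 'C(N.+1, n)%:R =
  \sum_(n < M.+1) (-1) ^+ (i + n) * 'C(n, i)%:R * 'C(N, n)%:R +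
  \sum_(n < M) (-1) ^+ (i + n.+1) * 'C(n.+1, i)%:R * 'C(N, n)%:R :> R.
  rewrite !(big_ord_recl M) !bin0 -addrA; congr (_ + _).
  rewrite -big_split/=; apply: eq_bigr => n _.
  by rewrite binS natrD mulrDr.
rewrite S IH//; last exact: ltnW.
case: i {S} => [|i].
  under eq_bigr => n _ do rewrite bin0 mulr1 add0n exprS mulN1r mulNr.
  rewrite sumrN.
  have := IH 0%N M NM; under eq_bigr => n _ do rewrite bin0 mulr1 add0n.
  by move=> ->; rewrite subrr.
under eq_bigr => n _ do rewrite binS natrD mulrDr mulrDl addnS exprS mulN1r.
rewrite big_split/=.
under eq_bigr => n _ do rewrite !mulNr.
rewrite sumrN IH// addrA subrr add0r eqSS -(IH i M NM).
by apply: eq_bigr => n _; rewrite addSn exprS mulN1r opprK.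
Qed.

(** * From binomial moments to the law of the number of intersections *)

Section needle_statistics.
Context {R : realType} {disp : measure_display} {T : measurableType disp}.
Variables (P : probability T R) (d : nat) (tau l : R) (a : 'I_d -> R).
Hypotheses (d0 : (0 < d)%N) (l0 : 0 < l) (a0 : forall i, 0 < a i).
Hypothesis la : forall i, l <= a i.
Variables X U : {mfun T >-> d.-tuple R}.
Hypotheses (hX : uniform_on_box P a0 X) (hU : uniform_on_sphere P U).
Hypothesis hXU : independent_vectors P X U.

Let lam i := l / a i.
Let N w := #|needle_hits tau l a X U w|.

Let binE n w : 'C(N w, n)%:R =
  \sum_(J : {set 'I_d} | #|J| == n) (J \subset needle_hits tau l a X U w)%:R :>
    R.
Proof.
rewrite -cards_draws -sum1_card natr_sum big_mkcond [RHS]big_mkcond/=.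
apply: eq_bigr => J _; rewrite inE; case: (J \subset _) => //=.
by case: ifP.
Qed.

Lemma measurable_bin_hits n : measurable_fun setT (fun w => 'C(N w, n)%:R : R).
Proof.
rewrite (_ : (fun w => _) = (fun w =>
  \sum_(J : {set 'I_d}) (if #|J| == n then \1_[set w | J \subset needle_hits
    tau l a X U w] w else 0 : R))).
  apply: measurable_sum => J; case: eqP => // _.
  by apply: measurable_indic; exact: measurable_needle_all_hits.
apply/funext => w; rewrite binE big_mkcond; apply: eq_bigr => J _.
by case: ifP => // _; rewrite indicE mem_setE.
Qed.

Lemma integral_bin_hits n :
  (\int[P]_w ('C(N w, n)%:R)%:E = (h_coef R d n * elem_sym n lam)%:E)%E.
Proof.
have mA := measurable_needle_all_hits tau l a X U.
transitivity (\int[P]_w (\sum_(J : {set 'I_d} | #|J| == n)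
    (\1_[set w | J \subset needle_hits tau l a X U w] w)%:E))%E.
  apply: eq_integral => w _; rewrite binE -sumEFin; apply: eq_bigr => J _.
  by rewrite indicE mem_setE.
rewrite integral_sum//; last by move=> J; exact: integrable_indic.
transitivity (\sum_(J : {set 'I_d} | #|J| == n)
    (h_coef R d n * \prod_(j in J) lam j)%:E)%E.
  apply: eq_bigr => J /eqP <-.
  rewrite integral_indic// setIT mulrC.
  exact: (needle_all_hits tau d0 l0 la hX hU hXU J).
by rewrite sumEFin -mulr_sumr elem_symE.
Qed.

(** By linearity, the binomial moments give the expectation of anything expanded in binomials.
    Probabilities, mean and variance are instances of such expansions. *)
Lemma integral_hits_poly (phi : nat -> R) (c : nat -> R) :
  (forall k, (k <= d)%N -> phi k = \sum_(n < d.+1) c n * 'C(k, n)%:R) ->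
  (\int[P]_w (phi (N w))%:E =
   (\sum_(n < d.+1) c n * (h_coef R d n * elem_sym n lam))%:E)%E.
Proof.
move=> phiE.
have Nd w : (N w <= d)%N by rewrite -[X in (_ <= X)%N]card_ord max_card.
transitivity (\int[P]_w (\sum_(n < d.+1) (c n)%:E * ('C(N w, n)%:R)%:E))%E.
  apply: eq_integral => w _; rewrite phiE// -sumEFin.
  by apply: eq_bigr => n _; rewrite EFinM.
have ibin n : P.-integrable setT (fun w => ('C(N w, n)%:R : R)%:E).
  apply/integrableP; split; first exact/measurable_EFinP/measurable_bin_hits.
  under eq_integral do rewrite gee0_abs ?lee_fin//.
  by rewrite integral_bin_hits ltry.
rewrite integral_sum//; last by move=> n; exact: integrableZl.
rewrite -sumEFin; apply: eq_bigr => n _.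
by rewrite integralZl// integral_bin_hits.
Qed.

Lemma measurable_hits_poly (phi : nat -> R) (c : nat -> R) :
  (forall k, (k <= d)%N -> phi k = \sum_(n < d.+1) c n * 'C(k, n)%:R) ->
  measurable_fun setT (fun w => phi (N w)).
Proof.
move=> phiE.
have Nd w : (N w <= d)%N by rewrite -[X in (_ <= X)%N]card_ord max_card.
rewrite (_ : (fun w => _) = fun w => \sum_(n < d.+1) c n * 'C(N w, n)%:R).
  by apply: measurable_sum => n; apply: measurable_funM => //;
    exact: measurable_bin_hits.
by apply/funext => w; rewrite phiE.
Qed.

Let Z w := intersections tau l a (X w) (U w).

Lemma counting_eqP (E : choiceType) (A : set E) n :
  counting A = n%:R%:E :> \bar R <->
  (n%:R%:E <= counting A :> \bar R)%E /\
  ~ (n.+1%:R%:E <= counting A :> \bar R)%E.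
Proof.
split=> [->|]; first by rewrite !lee_fin !ler_nat ltnn.
rewrite /counting; case: asboolP => _; last by move=> [_]; rewrite leey.
rewrite !lee_fin !ler_nat => -[h1 /negP]; rewrite -ltnNge ltnS => h2.
by congr (_%:R%:E); apply/eqP; rewrite eqn_leq h1 h2.
Qed.

Lemma counting_natP (E : choiceType) (A : set E) :
  counting A = +oo%E :> \bar R \/ exists n, counting A = n%:R%:E :> \bar R.
Proof. by rewrite /counting; case: asboolP => _; [right; eexists|left]. Qed.

Lemma measurable_intersections_eq n : measurable [set w | Z w = n%:R%:E].
Proof.
have mge m : measurable [set w | (m%:R%:E <= Z w)%E].
  have mY : measurable_fun setT (fun w => (U w, X w)).
    by apply/measurable_fun_pairP; split; exact: measurable_funPT.
  have := mY measurableT _ (measurable_le_intersections tau a l0 m).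
  by rewrite setTI.
rewrite (_ : [set w | _] = [set w | (n%:R%:E <= Z w)%E] `\`
    [set w | (n.+1%:R%:E <= Z w)%E]); first exact: measurableD.
by apply/seteqP; split => w /= /counting_eqP.
Qed.

Lemma measurable_fine_intersections : measurable_fun setT (fine \o Z).
Proof.
move=> _ B mB; rewrite setTI.
(* [Z] is a natural number or [+oo], and [fine] sends the latter to 0. *)
rewrite (_ : _ @^-1` B = (\bigcup_n [set w | B n%:R /\ Z w = n%:R%:E]) `|`
   [set w | B 0 /\ (~` \bigcup_n [set w | Z w = n%:R%:E]) w]).
  have mcond (b : Prop) (A : set T) : measurable A -> measurable [set w | b /\
    A w].
    move=> mA; have [pb|nb] := pselect b.
      by rewrite (_ : [set w | _] = A)//; apply/seteqP; split => // w [].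
    by rewrite (_ : [set w | _] = set0)//; apply/seteqP; split => // w [].
  apply: measurableU.
    by apply: bigcupT_measurable => n; apply: mcond;
      exact: measurable_intersections_eq.
  apply: mcond; apply: measurableC; apply: bigcupT_measurable => n.
  exact: measurable_intersections_eq.
apply/seteqP; split => w /=; rewrite /preimage/=.
  have [e|[n e]] := counting_natP (needle tau l (X w) (U w) `&` grid a);
    rewrite /Z /intersections e /= => Bw; [right|left; by exists n].
  by split => // -[n _ /=]; rewrite /Z /intersections e.
move=> [[n _ [Bn ->]]//|[B0 nZ]].
have [e|[n e]] := counting_natP (needle tau l (X w) (U w) `&` grid a).
  by rewrite /Z /intersections e.
by exfalso; apply: nZ; exists n.
Qed.

Lemma intersections_ae : {ae P, forall w, Z w = (N w)%:R%:E}.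
Proof.
have mY : measurable_fun setT (fun w => (U w, X w)).
  by apply/measurable_fun_pairP; split; exact: measurable_funPT.
have mD : measurable [set w | degenerate tau l a (U w, X w)].
  by have := mY measurableT _ (measurable_degenerate tau l a); rewrite setTI.
have mS : measurable (U @^-1` (~` @unit_sphere R d)).
  rewrite -[X in measurable X]setTI; apply: measurable_funPT => //.
  by apply: measurableC; exact: measurable_unit_sphere.
exists ([set w | degenerate tau l a (U w, X w)] `|` U @^-1` (~` @unit_sphere R
  d)).
split; first exact: measurableU.
  rewrite measureU0//; first exact: (degenerate_null tau l hX hXU).
  exact: sphere_ae.
move=> w /= H; apply: contrapT => /not_orP[nd /contrapT Sw]; apply: H.
exact: (@intersections_generic R d tau l a l0 a0 la (U w, X w) Sw nd).
Qed.

Lemma integral_intersections (psi : R -> R) (c : nat -> R) :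
  measurable_fun setT psi ->
  (forall k, (k <= d)%N -> psi k%:R = \sum_(n < d.+1) c n * 'C(k, n)%:R) ->
  (\int[P]_w (psi (fine (Z w)))%:E =
   (\sum_(n < d.+1) c n * (h_coef R d n * elem_sym n lam))%:E)%E.
Proof.
move=> mpsi psiE.
rewrite -(@integral_hits_poly (fun k => psi k%:R) c psiE).
apply: ae_eq_integral => //.
- apply/measurable_EFinP;
  exact: (measurableT_comp mpsi measurable_fine_intersections).
- apply/measurable_EFinP; exact: (measurable_hits_poly psiE).
- by apply: filterS intersections_ae => w -> _.
Qed.

Lemma probability_intersections i : (i <= d)%N ->
  P [set w | Z w = i%:R%:E] =
  (\sum_(n < d.+1) (-1) ^+ (i + n) * 'C(n, i)%:R *
     (h_coef R d n * elem_sym n lam))%:E.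
Proof.
move=> id.
pose phi (k : nat) : R := (k == i)%:R.
(* Coefficients of the indicator of [i] in the binomials, given by the inverse Pascal matrix. *)
pose c (n : nat) : R := (-1) ^+ (i + n) * 'C(n, i)%:R.
have phiE k : (k <= d)%N -> phi k = \sum_(n < d.+1) c n * 'C(k, n)%:R.
  by move=> kd; rewrite -[RHS]/(\sum_(n < d.+1) (-1) ^+ (i + n) * 'C(n, i)%:R *
    'C(k, n)%:R) binomial_orthogonality.
apply: etrans; last exact: (integral_hits_poly phiE).
rewrite -[in LHS](setIT [set w | _]) -integral_indic//; last first.
  exact: measurable_intersections_eq.
apply: ae_eq_integral => //.
- apply/measurable_EFinP; apply: measurable_indic.
  exact: measurable_intersections_eq.
- apply/measurable_EFinP; exact: (measurable_hits_poly phiE).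
- apply: filterS intersections_ae => w /= E _; congr (_%:R%:E).
  have [e|e] := eqVneq (N w) i.
    by rewrite mem_set//= E e.
  rewrite memNset//= E => -[] /eqP; rewrite eqr_nat.
  by rewrite (negbTE e).
Qed.

End needle_statistics.

Theorem theorem3p1 (R : realType) (disp : measure_display)
  (T : measurableType disp) (P : probability T R)
  (d : nat) (hd : (2 <= d)%N)
  (l : R) (hl : 0 < l)
  (a : 'I_d -> R) (a0 : forall i, 0 < a i) (hla : forall i, l <= a i)
  (tau : R) (htau : 0 <= tau <= 1)
  (X U : {mfun T >-> d.-tuple R})
  (hX : uniform_on_box P a0 X)
  (hU : uniform_on_sphere P U)
  (hXU : independent_vectors P X U) :
  let lambda := fun i => l / a i in
  let Z := fun w => intersections tau l a (X w) (U w) in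
  let c := 2 * Gamma (d%:R / 2) /
           ((d%:R - 1) * Num.sqrt pi * Gamma ((d%:R - 1) / 2)) : R in
  [/\ forall i : nat, (i <= d)%N ->
        P [set w | Z w = i%:R%:E] =
        (\sum_(i <= n < d.+1)
           (-1) ^+ (i + n) * 'C(n, i)%:R * h_coef R d n * elem_sym n lambda)%:E,
      ('E_P[fine \o Z])%E = (c * elem_sym 1 lambda)%:E
    & ('V_P[fine \o Z])%E =
        (c * elem_sym 1 lambda + 4 / (d%:R * pi) * elem_sym 2 lambda
         - (c * elem_sym 1 lambda) ^+ 2)%:E].
Proof.
move=> lambda Z c.
have d0 : (0 < d)%N by exact: ltn_trans hd.
have h0 : h_coef R d 0 = 1.
  have [_ G0] := @Gamma_half R d d0.
  by rewrite h_coefE// mul0r addr0 expr0 mul1r divff// gt_eqF.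
have h1 : h_coef R d 1 = c.
  rewrite /h_coef hd /c big_nat1 expr1 mulr0 addr0 -[1%:R / 2]/(1 / 2) div1r.
  by rewrite powR12_sqrt ?pi_ge0//; congr (_ / _); ring.
(* [Gamma (d / 2 + 1)] is [d / 2] times [Gamma (d / 2)], so the Gamma values cancel. *)
have h2 : h_coef R d 2 = 2 / (d%:R * pi).
  have [_ G0] := @Gamma_half R d d0.
  rewrite h_coefE// sqr_sqrtr ?pi_ge0// divff ?pnatr_eq0//.
  rewrite GammaD1 ?divr_gt0 ?ltr0n//.
  have pi0 : pi != 0 :> R by rewrite gt_eqF// pi_gt0.
  move: pi pi0 => q q0.
  by field; rewrite q0 pnatr_eq0 -lt0n d0 gt_eqF.
have e0 : elem_sym 0 lambda = 1.
  rewrite elem_symE (eq_bigl (pred1 finset.set0)).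
    by rewrite big_pred1_eq finset.big_set0.
  by move=> J; rewrite cards_eq0.
(* Mean and variance involve polynomials of degree at most 2, and [2 <= d] ensures that the indices
   0, 1, 2 all occur in the sum. *)
have sum3 (b g : nat -> R) : (forall n, b n.+3 = 0) ->
    \sum_(n < d.+1) b n * g n = b 0%N * g 0%N + b 1%N * g 1%N + b 2%N * g 2%N.
  move: hd; set m := d; case: m => [|[|m]]// _ b0;
    rewrite !big_ord_recl big1 ?addr0 ?addrA//.
  by move=> n _; rewrite b0 mul0r.
have stat := @integral_intersections _ _ _ P d tau l a d0 hl a0 hla X U hX hU
  hXU.
have EZ : ('E_P[fine \o Z])%E = (c * elem_sym 1 lambda)%:E.
  pose b (n : nat) : R := (n == 1%N)%:R.
  rewrite unlock; apply: etrans; first apply: (stat id b) => //.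
    move=> k kd; rewrite (sum3 b (fun n => 'C(k, n)%:R))// /b/=.
    by rewrite !mul0r add0r addr0 mul1r bin1.
  congr EFin; rewrite (sum3 b (fun n =>
    h_coef R d n * elem_sym n lambda))// /b/=.
  by rewrite !mul0r add0r addr0 mul1r h1.
split => //.
- move=> i id; rewrite (probability_intersections tau d0 hl hla hX hU hXU)//.
  congr EFin; rewrite [in RHS]big_geq_mkord.
  rewrite [RHS]big_mkcond/=; apply: eq_bigr => n _.
  case: ifPn => [_|]; first by rewrite !mulrA.
  by rewrite -ltnNge => ni; rewrite bin_small// mulr0 !mul0r.
- rewrite /variance unlock EZ unlock /=.
  set m := c * elem_sym 1 lambda.
  (* [(k - m)^2 = m^2 + (1 - 2 m) 'C(k, 1) + 2 'C(k, 2)]; the last 2 turns [2 / (d pi)] into the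
     [4 / (d pi)] of the variance. *)
  pose b (n : nat) : R := if n == 0%N then m ^+ 2 else
    if n == 1%N then 1 - 2 * m else if n == 2%N then 2 else 0.
  apply: etrans; first apply: (stat (fun x => (x - m) * (x - m)) b) => //.
  + by apply: measurable_funM; exact: measurable_funB.
  + move=> k kd; rewrite (sum3 b (fun n => 'C(k, n)%:R))// /b/= bin0 bin1.
    have -> : 2 * 'C(k, 2)%:R = k%:R * (k%:R - 1) :> R.
      case: k {kd} => [|k]; first by rewrite mul0r mulr0.
      have -> : k.+1%:R - 1 = k%:R :> R by rewrite -natr1 addrK.
      by rewrite -!natrM -(mul_bin_diag k.+1) bin1.
    ring.
  + congr EFin; rewrite (sum3 b (fun n =>
    h_coef R d n * elem_sym n lambda))// /b/=.
    by rewrite h0 e0 h1 h2 -/m; ring.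
Qed.
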